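(* Let $OAVD$ be a concave quadrilateral with concave (reflex) vertex $V$. Let $B$ be the point of the side $OA$ on the straight line $DV$, and let $C$ be the point of the side $OD$ on the straight line $AV$. Let $\vec u=\frac{B-A}{|B-A|}$, $M_0=A$, $N_0=C$. For a point $M$ of the segment $AB$ let $op(M)$ be the point of the segment $CD$ such that the straight line determined by $M$ and $op(M)$ contains $V$ (so $op(A)=C$ and $op(B)=D$). For $n\in\mathbb N$, $n\ge 1$, put $$app_+(n)(\ell)=\sum_{i=1}^n\rho\Big(M_0+\tfrac{i-1}{n}|B-A|\vec u,\;M_0+\tfrac{i}{n}|B-A|\vec u,\;N_0,\;op\big(M_0+\tfrac{i}{n}|B-A|\vec u\big);\ell\Big),$$ $$app_-(n)(\ell)=\sum_{i=1}^n\rho\Big(M_0+\tfrac{i-1}{n}|B-A|\vec u,\;M_0+\tfrac{i}{n}|B-A|\vec u,\;N_0,\;op\big(M_0+\tfrac{i-1}{n}|B-A|\vec u\big);\ell\Big).$$ One has $app_-(n)(\ell)\le\rho_{conc}(AB,CD)(\ell)\le app_+(n)(\ell)$ for all $n$, and $app_+(n)(\ell)-app_-(n)(\ell)\to 0$ as $n\to\infty$. Consequently, for every length $\ell>0$, $$\lim_{n\to\infty}app_-(n)(\ell)=\lim_{n\to\infty}app_+(n)(\ell)=\rho_{conc}(AB,CD)(\ell).$$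
   Context: $\mu$ is the translation- and rotation-invariant measure on the straight lines of the plane, normalized so that the lines of a given direction are measured by their cross section and directions by their angle ($d\mu=dp\,d\theta$). A chord joining two segments is the piece of a straight line meeting both segments that lies between its intersection points with them. Sets of chords carry the measure $\mu$ of the corresponding lines. The density of measure of the length of a set of chords is the density, with respect to the length $\ell$, of the $\mu$-measure of the chords of the set. For points $P,P',Q,Q'$, $\rho(P,P',Q,Q';\ell)$ is the value at $\ell$ of the density of measure of the length of the chords joining the segments $PP'$ and $QQ'$. It is $0$ if one of the segments reduces to a point. For the segments used here, which lie on the lines $OA$ and $OD$, it is given explicitly as follows. Let $\gamma$ be the angle at $O$, let $p\le p'$ be the distances from $O$ to the endpoints of one segment, and let $q\le q'$ be the distances from $O$ to the endpoints of the other. Then the density is $\rho(p',q',\gamma;\ell)-\rho(p,q',\gamma;\ell)-\rho(p',q,\gamma;\ell)+\rho(p,q,\gamma;\ell)$. Here $\rho(a,b,\gamma;\ell)$ is the density of measure of the length of the chords joining two segments of lengths $a,b$ issuing from a common point at angle $\gamma$: $$\rho(a,b,\gamma;\ell)=\frac1{\sin\gamma}\left[\int_\gamma^{\pi-\alpha}\sin\theta\,\sin(\theta-\gamma)\,H\Big(\frac{a\sin\gamma}{\sin\theta}-\ell\Big)d\theta+\int_\gamma^{\pi-\beta}\sin\theta\,\sin(\theta-\gamma)\,H\Big(\frac{b\sin\gamma}{\sin\theta}-\ell\Big)d\theta\right],$$ where $\alpha$ and $\beta$ are the angles opposite to the sides $a$ and $b$ in the triangle with sides $a,b$ enclosing the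 angle $\gamma$, and $H$ is the Heaviside function ($1$ for positive argument, $0$ otherwise). It is $0$ if $a=0$ or $b=0$. $\rho_{conc}(AB,CD)(\ell)$ is the value at $\ell$ of the density of measure of the length of those chords joining the segments $AB$ and $CD$ that are contained in the quadrilateral $OAVD$, i.e. those that pass $V$ on the same side as $O$. *)

(* Defs.v *)
From HB Require Import structures.
From mathcomp Require Import all_boot all_order all_algebra.
From mathcomp Require Import all_classical all_reals all_analysis.
Set Implicit Arguments.
Unset Strict Implicit.
Unset Printing Implicit Defensive.
Import Order.TTheory GRing.Theory Num.Theory.
Import numFieldNormedType.Exports.
Local Open Scope classical_set_scope.
Local Open Scope ring_scope.

(* Points of the plane are pairs of reals. The library norm on R * R is the
   sup norm, so the Euclidean norm is defined here. *)
Definition enorm {R : realType} (u : R * R) : R :=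
  Num.sqrt (u.1 ^+ 2 + u.2 ^+ 2).

Definition dist {R : realType} (P Q : R * R) : R := enorm (Q - P).

(* The angle at P between the rays PQ and PS. *)
Definition angle {R : realType} (P Q S : R * R) : R :=
  let u := Q - P in let v := S - P in
  acos ((u.1 * v.1 + u.2 * v.2) / (enorm u * enorm v)).

Definition segment {R : realType} (P Q : R * R) : set (R * R) :=
  [set P + t *: (Q - P) | t in `[0, 1]].

Definition line {R : realType} (P Q : R * R) : set (R * R) :=
  [set P + t *: (Q - P) | t in setT].

Definition triangle {R : realType} (P Q S : R * R) : set (R * R) :=
  [set X | exists a b c : R, [/\ 0 <= a, 0 <= b, 0 <= c, a + b + c = 1 &
                                 X = a *: P + b *: Q + c *: S]].

(* Positive iff the polygonal path P, Q, S turns left at Q. *)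
Definition turn {R : realType} (P Q S : R * R) : R :=
  (Q.1 - P.1) * (S.2 - Q.2) - (Q.2 - P.2) * (S.1 - Q.1).

(* The closed polygon O A V D has a reflex angle at V: it turns strictly in
   one direction at O, A and D, and strictly in the other one at V. The two
   cases are the two orientations of the polygon. These signs say that V is
   strictly inside the triangle OAD, so the polygon is automatically simple. *)
Definition concave_quadrilateral {R : realType} (O A V D : R * R) : Prop :=
  [/\ 0 < turn D O A, 0 < turn O A V, turn A V D < 0 & 0 < turn V D O] \/
  [/\ turn D O A < 0, turn O A V < 0, 0 < turn A V D & turn V D O < 0].

(* The closed region bounded by a quadrilateral with reflex vertex V: the
   diagonal OV cuts it into two triangles. *)
Definition quadrilateral_region {R : realType} (O A V D : R * R) :
  set (R * R) := triangle O A V `|` triangle O V D.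

(* The line with normal direction (cos theta, sin theta), at signed distance p
   from the origin. Each line is obtained from exactly one pair (p, theta)
   with 0 <= theta < pi. *)
Definition normal_line {R : realType} (p theta : R) : set (R * R) :=
  [set X | X.1 * cos theta + X.2 * sin theta = p].

(* The invariant measure dp dtheta on straight lines, applied to the set of
   lines satisfying L. *)
Definition line_measure {R : realType} (L : set (set (R * R))) : \bar R :=
  ((@lebesgue_measure R) \x (@lebesgue_measure R))%E
    [set z : measurableTypeR R * measurableTypeR R |
      0 <= z.2 < pi /\ L (normal_line z.1 z.2)].

(* A set of chords is a set S of pairs of (distinct) endpoints. This is the
   measure of the lines carrying a chord of S of length at most l. *)
Definition chord_length_cdf {R : realType} (S : set ((R * R) * (R * R)))
    (l : R) : R :=
  fine (line_measure [set L | exists M N,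
    [/\ S (M, N), L M, L N & dist M N <= l]]).

(* Density with respect to the length; the derivative fixes its value at
   every l, not only almost everywhere. *)
Definition chord_length_density {R : realType} (S : set ((R * R) * (R * R)))
    (l : R) : R :=
  derive1 (chord_length_cdf S) l.

Definition conc_chords {R : realType} (O A V D B C : R * R) :
    set ((R * R) * (R * R)) :=
  [set c | [/\ segment A B c.1, segment C D c.2 &
               segment c.1 c.2 `<=` quadrilateral_region O A V D]].

Definition rho_conc {R : realType} (O A V D B C : R * R) (l : R) : R :=
  chord_length_density (conc_chords O A V D B C) l.

Definition heaviside {R : realType} (x : R) : R := if 0 < x then 1 else 0.

(* rho(a, b, gamma; l). The triangle with sides a, b enclosing gamma is
   realized as (0, Pa, Pb); its angle opposite to a is at Pb, and its angle
   opposite to b is at Pa. *)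
Definition rho_sides {R : realType} (a b gamma l : R) : R :=
  if (a == 0) || (b == 0) then 0 else
  let Pa : R * R := (a, 0) in
  let Pb : R * R := (b * cos gamma, b * sin gamma) in
  let alpha := angle Pb 0 Pa in
  let beta := angle Pa 0 Pb in
  (sin gamma)^-1 *
  (\int[@lebesgue_measure R]_(theta in `[gamma, pi - alpha])
     (sin theta * sin (theta - gamma) *
      heaviside (a * sin gamma / sin theta - l))
 + \int[@lebesgue_measure R]_(theta in `[gamma, pi - beta])
     (sin theta * sin (theta - gamma) *
      heaviside (b * sin gamma / sin theta - l))).

(* rho(P, P', Q, Q'; l), for segments PP' and QQ' lying on two rays issuing
   from O at angle gamma. *)
Definition rho {R : realType} (O : R * R) (gamma : R) (P P' Q Q' : R * R)
    (l : R) : R :=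
  let p := Num.min (dist O P) (dist O P') in
  let p' := Num.max (dist O P) (dist O P') in
  let q := Num.min (dist O Q) (dist O Q') in
  let q' := Num.max (dist O Q) (dist O Q') in
  rho_sides p' q' gamma l - rho_sides p q' gamma l
  - rho_sides p' q gamma l + rho_sides p q gamma l.

(* M_0 + (i / n) |B - A| u, where M_0 = A and u = (B - A) / |B - A|. *)
Definition subdivision {R : realType} (A B : R * R) (n i : nat) : R * R :=
  let u := (enorm (B - A))^-1 *: (B - A) in
  A + (i%:R / n%:R * enorm (B - A)) *: u.

Definition app_plus {R : realType} (O A D B C : R * R)
    (op : R * R -> R * R) (n : nat) (l : R) : R :=
  \sum_(1 <= i < n.+1)
    rho O (angle O A D) (subdivision A B n i.-1) (subdivision A B n i)
        C (op (subdivision A B n i)) l.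

Definition app_minus {R : realType} (O A D B C : R * R)
    (op : R * R -> R * R) (n : nat) (l : R) : R :=
  \sum_(1 <= i < n.+1)
    rho O (angle O A D) (subdivision A B n i.-1) (subdivision A B n i)
        C (op (subdivision A B n i.-1)) l.

(* Main.v *)
Require Import Defs.
From HB Require Import structures.
From mathcomp Require Import all_boot all_order all_algebra.
From mathcomp Require Import all_classical all_reals all_analysis measurable_realfun.
From mathcomp Require Import ring lra.

(** A line that crosses the rays OA and OD is determined by its direction and by
    the length l of the chord it cuts off. Let gamma be the angle at O, and let t
    be the exterior angle of the triangle formed by the chord and O, at the end
    of the chord on OD. By the law of sines the ends of the chord are at the
    distances m = l sin t / sin gamma and n = l sin (t - gamma) / sin gamma from
    O, and the line is at the distance l sin t sin (t - gamma) / sin gamma from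
    O. So the chords whose ends satisfy a condition P m n have at l the density
    [chord_density], the integral of sin t sin (t - gamma) / sin gamma over the t
    in ]gamma, pi[ for which P holds. Every density of the theorem has this form.

    For [rho], the two integrals of its definition together cover the directions
    in ]gamma, pi[, each with the constraint that is binding there
    ([rho_sides_chord_density]); by inclusion and exclusion the condition P is
    that (m, n) lies in a rectangle ([rho_chord_density]).

    For [rho_conc], let e and h be the coordinates of V along OA and OD. A chord
    from AB to CD stays in the quadrilateral exactly when m n <= e n + h m
    ([segment_in_region]). Integrating over all lines, by periodicity in the
    direction and by Tonelli's theorem, shows that the distribution function of
    the length is a primitive of the density for this P ([chord_length_cdfE]).

    The sums app_- and app_+ are then the densities for two unions of rectangles,
    below and above the curve m n = e n + h m ([app_minusE], [app_plusE]). These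
    staircases enclose the region below the curve, which gives the inequalities.
    For fixed l > 0 the point (m, n) lies on the boundary of the region only if
    cot t is a root of one of finitely many nonzero polynomials, that is for
    finitely many t ([null_critical_angles]). For every other t the conditions
    are eventually constant, both when l' tends to l and when n tends to
    infinity. Dominated convergence ([chord_density_cvg]) then gives the
    continuity of the density in l, hence the derivability of the distribution
    function at every l > 0, and the convergence of both sums. *)

Set Implicit Arguments.
Unset Strict Implicit.
Unset Printing Implicit Defensive.
Import Order.TTheory GRing.Theory Num.Theory.
Import numFieldNormedType.Exports.
Local Open Scope classical_set_scope.
Local Open Scope ring_scope.

(** * Affine substitutions and integrals over a period *)

Lemma measurable_affine (R : realType) (k c : R) :
  measurable_fun [set: R] (fun x : R => k * x + c).
Proof. by apply: measurable_funD => //; exact: measurable_funM. Qed.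

(** The scaled push-forward of the Lebesgue measure by the affine map is a
    measure giving every half-open interval its length, hence is the Lebesgue
    measure. *)
Lemma lebesgue_measure_affine (R : realType) (k c : R) (A : set R) :
  k != 0 -> measurable A ->
  (@lebesgue_measure R A =
    `|k|%:E * @lebesgue_measure R ((fun x => (k * x + c)%R) @^-1` A))%E.
Proof.
move=> k0 mA.
pose f : measurableTypeR R -> measurableTypeR R := fun x => (k * x + c)%R.
have mf : measurable_fun setT f by exact: measurable_affine.
pose m : {measure set (measurableTypeR R) -> \bar R} :=
  mscale (NngNum (normr_ge0 k)) (pushforward (@lebesgue_measure R) f).
suff -> : @lebesgue_measure R A = m mf A by [].
apply: lebesgue_measure_unique => // _ [[a b]] /= _ <-.
rewrite /m /mscale /= /pushforward /=.
rewrite lebesgue_measure_itv/= lte_fin.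
have [k_gt0|k_lt0|k00] := ltgtP 0 k; last by rewrite -k00 eqxx in k0.
- have -> : (fun x : R => k * x + c) @^-1` `]a, b] =
    `](a - c) / k, (b - c) / k]%classic.
    apply/seteqP; split=> x /=; rewrite !in_itv/= ltr_pdivrMr // ler_pdivlMr //;
      by rewrite ltrBlDr lerBrDr (mulrC x).
  rewrite lebesgue_measure_itv/= lte_fin ltr_pM2r ?invr_gt0 // ltrD2r.
  case: ifPn => ab; last by rewrite mule0.
  by rewrite gtr0_norm// -!EFinB -EFinM; congr EFin; field; rewrite gt_eqF.
- have -> : (fun x : R => k * x + c) @^-1` `]a, b] =
    `[(b - c) / k, (a - c) / k[%classic.
    apply/seteqP; split=> x /=; rewrite !in_itv/= ltr_ndivlMr // ler_ndivrMr //;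
      by rewrite ltrBlDr lerBrDr (mulrC x) andbC.
  rewrite lebesgue_measure_itv/= lte_fin ltr_nM2r ?invr_lt0 // ltrD2r.
  case: ifPn => ab; last by rewrite mule0.
  by rewrite ltr0_norm// -!EFinB -EFinM; congr EFin; field; rewrite lt_eqF.
Qed.

Lemma ge0_integral_affine (R : realType) (k c : R) (D : set R)
    (f : R -> \bar R) :
  k != 0 -> measurable D -> measurable_fun D f ->
  (forall x, D x -> (0 <= f x)%E) ->
  (\int[@lebesgue_measure R]_(x in D) f x =
    `|k|%:E * \int[@lebesgue_measure R]_(x in (fun x => (k * x + c)%R) @^-1` D)
                 f (k * x + c)%R)%E.
Proof.
move=> k0 mD mf f0.
pose h : measurableTypeR R -> measurableTypeR R := fun x => (k * x + c)%R.
have mh : measurable_fun setT h by exact: measurable_affine.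
pose m : {measure set (measurableTypeR R) -> \bar R} :=
  mscale (NngNum (normr_ge0 k)) (pushforward (@lebesgue_measure R) h).
rewrite (eq_measure_integral (m mh)); last first.
  by move=> A mA _; exact: lebesgue_measure_affine.
rewrite ge0_integral_mscale//; congr (_ * _)%E.
by rewrite ge0_integral_pushforward// => y; rewrite inE => /f0.
Qed.

Section periodic.
Context {R : realType}.
Local Notation mu := (@lebesgue_measure R).
Variables (g : R -> \bar R) (T : R).
Hypotheses (T0 : 0 < T) (mg : measurable_fun setT g)
  (g0 : forall x, (0 <= g x)%E) (gT : forall x, g (x + T) = g x).

Let mgD (D : set R) : measurable D -> measurable_fun D g.
Proof. by move=> mD; exact: measurable_funS mg. Qed.

Let periodic_nat (n : nat) x : g (x + n%:R * T) = g x.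
Proof.
elim: n x => [|n IH] x; first by rewrite mul0r addr0.
by rewrite -[in LHS]natr1 mulrDl mul1r addrA gT IH.
Qed.

Lemma periodic_int (k : int) x : g (x + k%:~R * T) = g x.
Proof.
case: k => n; first exact: periodic_nat.
by rewrite NegzE -(periodic_nat n.+1); congr g; rewrite mulrNz mulNr subrK.
Qed.

Let integral_shift (a b c : R) :
  (\int[mu]_(x in `[(a + c)%R, (b + c)%R[) g x = \int[mu]_(x in `[a, b[) g (x + c)%R)%E.
Proof.
have := @ge0_integral_affine R 1 c `[(a + c)%R, (b + c)%R[%classic g.
rewrite normr1 mul1e oner_eq0 => -> //; last by apply: mgD.
have -> : (fun x : R => 1 * x + c) @^-1` `[a + c, (b + c)[ = `[a, b[%classic.
  by apply/seteqP; split => x /=; rewrite !in_itv/= mul1r lerD2r ltrD2r.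
by under eq_integral do rewrite mul1r.
Qed.

(** Up to a multiple of the period the window starts at some r in [0, T]; the
    part of it beyond T is then the translate of [0, r[. *)
Lemma integral_window (c : R) :
  (\int[mu]_(x in `[c, (c + T)%R[) g x = \int[mu]_(x in `[0%R, T[) g x)%E.
Proof.
have small r : 0 <= r <= T ->
    (\int[mu]_(x in `[r, (r + T)%R[) g x = \int[mu]_(x in `[0%R, T[) g x)%E.
  move=> /andP[r0 rT].
  rewrite (@itv_bndbnd_setU _ _ _ (BLeft T)) ?bnd_simp//; last by lra.
  rewrite (@itv_bndbnd_setU _ _ (BLeft 0) (BLeft r)) ?bnd_simp//.
  rewrite !ge0_integral_setU//; first last.
  - apply/disj_setPS => x [] /=; rewrite !in_itv/= => /andP[_ xT] /andP[Tx _].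
    by move: xT; rewrite ltNge Tx.
  - by apply: mgD; exact: measurableU.
  - apply/disj_setPS => x [] /=; rewrite !in_itv/= => /andP[_ xT] /andP[Tx _].
    by move: xT; rewrite ltNge Tx.
  - by apply: mgD; exact: measurableU.
  rewrite addeC; congr (_ + _)%E.
  have := integral_shift 0 r T; rewrite add0r => ->.
  by apply: eq_integral => x _; rewrite gT.
pose k := Num.floor (c / T).
have ck : 0 <= c - k%:~R * T <= T.
  have /andP[kc ck] := mem_rg1_floor (c / T).
  move: kc ck; rewrite ler_pdivlMr// ltr_pdivrMr// mulrDl mul1r => kc ck.
  by rewrite subr_ge0 kc/= lerBlDl ltW.
have := integral_shift (c - k%:~R * T) (c - k%:~R * T + T) (k%:~R * T).
rewrite subrK addrAC subrK -(small _ ck) => ->.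
by apply: eq_integral => x _; rewrite periodic_int.
Qed.

Lemma integral_periodic_shift (c : R) :
  (\int[mu]_(x in `[0%R, T[) g (x + c)%R = \int[mu]_(x in `[0%R, T[) g x)%E.
Proof. by rewrite -integral_shift add0r (addrC T) integral_window. Qed.

Lemma integral_periodic_reflect (c : R) :
  (\int[mu]_(x in `[0%R, T[) g (c - x)%R = \int[mu]_(x in `[0%R, T[) g x)%E.
Proof.
have E : `[0%R, T[%classic = (fun x : R => -1 * x + c) @^-1` `]c - T, c].
  by apply/seteqP; split => x /=; rewrite !in_itv/= => /andP[? ?];
    apply/andP; split; lra.
have N1 : (-1 : R) != 0 by rewrite oppr_eq0 oner_eq0.
transitivity (\int[mu]_(x in `](c - T)%R, c]) g x)%E.
  rewrite [RHS](@ge0_integral_affine R (-1) c)//; last exact: mgD.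
  rewrite normrN1 mul1e -E; apply: eq_integral => x _.
  by rewrite mulN1r addrC.
rewrite integral_itv_obnd_cbnd; last by apply: mgD.
rewrite -integral_itv_bndo_bndc; last by apply: mgD.
by have := integral_window (c - T); rewrite subrK.
Qed.

End periodic.

(** * Densities of sets of chords between two half-lines *)

Section chords_of_angle.
Context {R : realType}.
Local Notation mu := (@lebesgue_measure R).
Implicit Types (gamma l t : R) (P Q : R -> R -> bool).

(** Let two half-lines enclose the angle gamma at O, and let a chord of length l
    joining them have the exterior angle t at its end on the second half-line.
    Its interior angles are t - gamma at its first end and pi - t at its second
    end, with gamma < t < pi, and the law of sines gives the distances of the
    two ends from O. *)
Definition foot1 gamma l t : R := l * sin t / sin gamma.

Definition foot2 gamma l t : R := l * sin (t - gamma) / sin gamma.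

(** The chord of length l lies on a line at distance kern gamma t * l from O.
    Hence dp = kern gamma t dl for a fixed direction, and kern gamma t dt is the
    density, in the length, of the invariant measure dp dt. *)
Definition kern gamma t : R := sin t * sin (t - gamma) / sin gamma.

(** The density at l of the chords whose ends, at distances m and n from O,
    satisfy P m n. *)
Definition chord_density gamma l P : R :=
  \int[mu]_(t in `]gamma, pi[)
    (kern gamma t * (P (foot1 gamma l t) (foot2 gamma l t))%:R).

Lemma integrable_bounded (D : set R) (f : R -> R) (M : R) :
  measurable D -> (mu D < +oo)%E -> measurable_fun D f ->
  (forall x, D x -> `|f x| <= M) -> mu.-integrable D (EFin \o f).
Proof.
move=> mD fD mf fM; apply: measurable_bounded_integrable => //.
exists M; split; first exact: num_real.
by move=> N MN x Dx; rewrite /= (le_trans (fM _ Dx))// ltW.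
Qed.

Lemma itv_finite (b1 b2 : bool) (a b : R) :
  (mu [set` Interval (BSide b1 a) (BSide b2 b)] < +oo)%E.
Proof. by rewrite lebesgue_measure_itv; case: ifPn => // _; rewrite -EFinB ltry. Qed.

Lemma measurable_sin (D : set R) : measurable_fun D (@sin R).
Proof.
by apply: measurable_funTS; apply: continuous_measurable_fun; exact: continuous_sin.
Qed.

Lemma measurable_cos (D : set R) : measurable_fun D (@cos R).
Proof.
by apply: measurable_funTS; apply: continuous_measurable_fun; exact: continuous_cos.
Qed.

Lemma measurable_kern gamma D : measurable_fun D (kern gamma).
Proof.
apply: measurable_funTS; apply: measurable_funM => //.
apply: measurable_funM; first exact: measurable_sin.
apply: measurableT_comp; first exact: measurable_sin.
exact: measurable_funB.
Qed.

Lemma measurable_foot1 gamma l D : measurable_fun D (foot1 gamma l).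
Proof.
apply: measurable_funTS; apply: measurable_funM => //.
by apply: measurable_funM => //; exact: measurable_sin.
Qed.

Lemma measurable_foot2 gamma l D : measurable_fun D (foot2 gamma l).
Proof.
apply: measurable_funTS; apply: measurable_funM => //.
apply: measurable_funM => //.
apply: measurableT_comp; first exact: measurable_sin.
exact: measurable_funB.
Qed.

Lemma measurable_natr_bool d (T : measurableType d) (D : set T) (b : T -> bool) :
  measurable_fun D b -> measurable_fun D (fun x => (b x)%:R : R).
Proof.
move=> mb; have -> : (fun x => (b x)%:R : R) = (fun c : bool => c%:R : R) \o b by [].
exact: measurableT_comp.
Qed.

Definition measurable_rel P :=
  measurable_fun setT (fun z : R * R => P z.1 z.2).

Lemma measurable_feet gamma l P D : measurable_rel P ->
  measurable_fun D (fun t => P (foot1 gamma l t) (foot2 gamma l t)).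
Proof.
move=> mP; apply: measurable_funTS.
apply: (measurableT_comp mP (g := fun t => (foot1 gamma l t, foot2 gamma l t))).
by apply: measurable_fun_pair; [exact: measurable_foot1|exact: measurable_foot2].
Qed.

Lemma measurable_chord_integrand gamma l P D : measurable_rel P ->
  measurable_fun D
    (fun t => kern gamma t * (P (foot1 gamma l t) (foot2 gamma l t))%:R).
Proof.
move=> mP; apply: measurable_funM; first exact: measurable_kern.
by apply: measurable_natr_bool; exact: measurable_feet.
Qed.

Lemma kern_le gamma t : 0 < gamma < pi -> `|kern gamma t| <= (sin gamma)^-1.
Proof.
move=> g; have s0 := sin_gt0_pi g.
rewrite /kern normrM normfV (gtr0_norm s0) ler_piMl ?invr_ge0 ?(ltW s0)//.
by rewrite normrM mulr_ile1// sin_max.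
Qed.

Lemma chord_integrand_le gamma (c : bool) t : 0 < gamma < pi ->
  `|kern gamma t * c%:R| <= (sin gamma)^-1.
Proof.
move=> g; rewrite normrM; case: c; first by rewrite normr1 mulr1 kern_le.
by rewrite normr0 mulr0 invr_ge0 ltW// sin_gt0_pi.
Qed.

Lemma integrable_chord gamma l P (D : set R) : 0 < gamma < pi ->
  measurable_rel P -> measurable D -> (mu D < +oo)%E ->
  mu.-integrable D
    (EFin \o (fun t => kern gamma t * (P (foot1 gamma l t) (foot2 gamma l t))%:R)).
Proof.
move=> g mP mD fD; apply: (@integrable_bounded _ _ (sin gamma)^-1) => //.
  exact: measurable_chord_integrand.
by move=> t _; exact: chord_integrand_le.
Qed.

Lemma kern_gt0 gamma t : 0 < gamma < pi -> gamma < t < pi -> 0 < kern gamma t.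
Proof.
move=> g /andP[gt tp]; have /andP[g0 gp] := g.
rewrite divr_gt0 ?mulr_gt0 ?sin_gt0_pi//.
- by rewrite tp andbT (lt_trans g0).
- by rewrite subr_gt0 gt/= ltrBlDr (lt_le_trans tp)// lerDl ltW.
Qed.

End chords_of_angle.

(** * The explicit density as a density of chords *)

Section rho_sides_density.
Context {R : realType}.
Local Notation mu := (@lebesgue_measure R).
Implicit Types (a b gamma l t : R).

(** The side opposite to gamma in the triangle with sides a, b enclosing gamma. *)
Definition third_side a b gamma : R :=
  Num.sqrt (a ^+ 2 + b ^+ 2 - 2 * a * b * cos gamma).

Let third_side_arg a b gamma :
  a ^+ 2 + b ^+ 2 - 2 * a * b * cos gamma =
    (a * sin gamma) ^+ 2 + (b - a * cos gamma) ^+ 2.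
Proof. by rewrite exprMn sin2cos2; ring. Qed.

Lemma third_side_sqr a b gamma :
  third_side a b gamma ^+ 2 = (a * sin gamma) ^+ 2 + (b - a * cos gamma) ^+ 2.
Proof. by rewrite sqr_sqrtr third_side_arg// addr_ge0// sqr_ge0. Qed.

Lemma third_sideC a b gamma : third_side a b gamma = third_side b a gamma.
Proof. by rewrite /third_side; congr Num.sqrt; ring. Qed.

Lemma third_side_gt0 a b gamma : 0 < a -> 0 < gamma < pi ->
  0 < third_side a b gamma.
Proof.
move=> a0 g; have p : 0 < (a * sin gamma) ^+ 2 + (b - a * cos gamma) ^+ 2.
  by rewrite ltr_pwDl ?sqr_ge0// exprn_gt0// mulr_gt0//; exact: sin_gt0_pi.
by rewrite -sqrtr0 ltr_sqrt third_side_arg.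
Qed.

(** The angle opposite to the side a in that triangle. *)
Definition opposite_angle a b gamma : R :=
  acos ((b - a * cos gamma) / third_side a b gamma).

Lemma opposite_angleP a b gamma : 0 < a -> 0 < gamma < pi ->
  let alpha := opposite_angle a b gamma in let c := third_side a b gamma in
  [/\ 0 < alpha < pi, c * cos alpha = b - a * cos gamma &
      c * sin alpha = a * sin gamma].
Proof.
move=> a0 g /=; have c0 := third_side_gt0 b a0 g.
have s0 := sin_gt0_pi g.
rewrite /opposite_angle; set c := third_side _ _ _ in c0 *; set x := _ / c.
have as0 : 0 < a * sin gamma by exact: mulr_gt0.
have cx : c * x = b - a * cos gamma by rewrite /x mulrC divfK// gt_eqF.
have e : 1 - x ^+ 2 = (a * sin gamma / c) ^+ 2.
  rewrite [RHS]expr_div_n; apply: (@mulfI _ (c ^+ 2)); first by rewrite gt_eqF ?exprn_gt0.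
  rewrite [RHS]mulrC divfK; last by rewrite gt_eqF ?exprn_gt0.
  by rewrite mulrBr mulr1 -exprMn cx third_side_sqr addrK.
have x2 : x ^+ 2 < 1 by rewrite -subr_gt0 e exprn_gt0// divr_gt0.
have /andP[x1 x1'] : -1 < x < 1 by rewrite -ltr_norml -sqrtr_sqr -sqrtr1 ltr_sqrt.
have xI : -1 <= x <= 1 by rewrite !ltW.
split.
- by rewrite acos_gt0 ?acos_ltpi// ?x1 ?x1' ?ltW.
- by rewrite acosK.
- by rewrite sin_acos// e sqrtr_sqr gtr0_norm ?divr_gt0// mulrC divfK// gt_eqF.
Qed.

(** The cosine and the sine of the sum are those of pi - gamma; the sine also
    rules out a sum larger than pi. *)
Lemma sum_opposite_angles a b gamma : 0 < a -> 0 < b -> 0 < gamma < pi ->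
  opposite_angle a b gamma + opposite_angle b a gamma = pi - gamma.
Proof.
move=> a0 b0 g; have c0 := third_side_gt0 b a0 g.
have [aI ca sa] := opposite_angleP b a0 g.
have [bI] := opposite_angleP a b0 g; rewrite -third_sideC => cb sb.
move: aI bI ca sa cb sb; set c := third_side _ _ _ in c0 *.
set A := opposite_angle a b gamma; set B := opposite_angle b a gamma.
move=> /andP[A0 Api] /andP[B0 Bpi] ca sa cb sb.
have s0 := sin_gt0_pi g; have /andP[g0 gp] := g.
have c2 := third_side_sqr a b gamma; rewrite -/c in c2.
have c2n0 : c ^+ 2 != 0 by rewrite gt_eqF ?exprn_gt0.
have cosAB : cos (A + B) = - cos gamma.
  apply: (mulfI c2n0); rewrite cosD.
  have -> : c ^+ 2 * (cos A * cos B - sin A * sin B) =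
    (c * cos A) * (c * cos B) - (c * sin A) * (c * sin B) by ring.
  rewrite ca cb sa sb c2 !exprMn.
  ring: (sin2cos2 gamma).
have sinAB : sin (A + B) = sin gamma.
  apply: (mulfI c2n0); rewrite sinD.
  have -> : c ^+ 2 * (sin A * cos B + cos A * sin B) =
    (c * sin A) * (c * cos B) + (c * cos A) * (c * sin B) by ring.
  by rewrite ca cb sa sb c2 !exprMn; ring: (sin2cos2 gamma).
have ABpi : A + B <= pi.
  rewrite leNgt; apply/negP => h.
  have : 0 < sin (A + B - pi) by apply: sin_gt0_pi; apply/andP; split; lra.
  rewrite sinB cospi sinpi mulr0 subr0 mulrN1 sinAB; lra.
apply: cos_inj; rewrite ?in_itv/=; try by apply/andP; split; lra.
by rewrite cosAB cosB cospi sinpi mul0r addr0 mulN1r.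
Qed.

Lemma angle_opposite1 a b gamma : 0 < b ->
  angle (b * cos gamma, b * sin gamma) 0 (a, 0) = opposite_angle a b gamma.
Proof.
move=> b0; rewrite /angle /opposite_angle /enorm /=; congr acos.
have -> : (0 - b * cos gamma) ^+ 2 + (0 - b * sin gamma) ^+ 2 = b ^+ 2.
  by ring: (sin2cos2 gamma).
have -> : (a - b * cos gamma) ^+ 2 + (0 - b * sin gamma) ^+ 2 =
    a ^+ 2 + b ^+ 2 - 2 * a * b * cos gamma.
  by ring: (sin2cos2 gamma).
rewrite sqrtr_sqr gtr0_norm// -/(third_side a b gamma) invfM mulrA.
congr (_ / _); apply: (mulIf (lt0r_neq0 b0)); rewrite divfK ?lt0r_neq0//.
by ring: (sin2cos2 gamma).
Qed.

Lemma angle_opposite2 a b gamma : 0 < a ->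
  angle (a, 0) 0 (b * cos gamma, b * sin gamma) = opposite_angle b a gamma.
Proof.
move=> a0; rewrite /angle /opposite_angle /enorm /=; congr acos.
have -> : (0 - a) ^+ 2 + (0 - 0) ^+ 2 = a ^+ 2 by ring.
have -> : (b * cos gamma - a) ^+ 2 + (b * sin gamma - 0) ^+ 2 =
    b ^+ 2 + a ^+ 2 - 2 * b * a * cos gamma.
  by ring: (sin2cos2 gamma).
rewrite sqrtr_sqr gtr0_norm// -/(third_side b a gamma) invfM mulrA.
congr (_ / _); apply: (mulIf (lt0r_neq0 a0)); rewrite divfK ?lt0r_neq0//.
by ring.
Qed.

(** Of the two constraints m <= a and n <= b on the ends of a chord, this decides
    which one is binding: the difference of the two sides of the inequality is
    a positive multiple of sin (t + alpha). *)
Lemma le_opposite a b gamma t : 0 < a -> 0 < b -> 0 < gamma < pi -> gamma < t < pi ->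
  (a * sin (t - gamma) <= b * sin t) = (t <= pi - opposite_angle a b gamma).
Proof.
move=> a0 b0 g /andP[gt tpi]; have c0 := third_side_gt0 b a0 g.
have [/andP[A0 Api] cA sA] := opposite_angleP b a0 g.
have s0 := sin_gt0_pi g; have /andP[g0 gp] := g.
set A := opposite_angle a b gamma in A0 Api cA sA *.
set c := third_side a b gamma in c0 cA sA.
have e : b * sin t - a * sin (t - gamma) = c * sin (t + A).
  rewrite sinB sinD.
  have -> : c * (sin t * cos A + cos t * sin A) =
    sin t * (c * cos A) + cos t * (c * sin A) by ring.
  by rewrite cA sA; ring.
rewrite -subr_ge0 e pmulr_rge0//; apply/idP/idP.
- apply: contraTT; rewrite -!ltNge => h.
  rewrite -oppr_gt0 -[- _](_ : sin (t + A - pi) = _).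
    by apply: sin_gt0_pi; apply/andP; split; lra.
  by rewrite sinB cospi sinpi mulr0 subr0 mulrN1.
- by move=> h; apply: sin_ge0_pi; apply/andP; split; lra.
Qed.

Lemma foot_transfer (l a b s x y : R) : 0 < a -> 0 < b -> 0 <= l ->
  a * y <= b * x -> l * x < a * s -> l * y < b * s.
Proof.
move=> a0 b0 l0 yx xs; rewrite -(ltr_pM2l a0).
have h1 : l * (a * y) <= l * (b * x) by rewrite ler_wpM2l.
have h2 : b * (l * x) < b * (a * s) by rewrite ltr_pM2l.
by rewrite mulrCA (le_lt_trans h1)// mulrCA (lt_le_trans h2)// mulrCA.
Qed.

Lemma heaviside_foot (a s l gamma : R) : 0 < s -> 0 < sin gamma ->
  heaviside (a * sin gamma / s - l) = ((l * s / sin gamma < a)%R : bool)%:R :> R.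
Proof.
move=> s0 g0; rewrite /heaviside subr_gt0 ltr_pdivlMr// ltr_pdivrMr//.
by case: ifP.
Qed.

(** The first integral covers the directions for which the end on the side of
    length a reaches the end of that side first. The reflection
    t -> pi + gamma - t exchanges the two ends of the chord and carries the
    second integral to the remaining directions. *)
Lemma rho_sides_chord_density a b gamma l : 0 < a -> 0 < b ->
  0 < gamma < pi -> 0 <= l ->
  rho_sides a b gamma l = chord_density gamma l (fun m n => (m < a) && (n < b)).
Proof.
move=> a0 b0 g l0; have /andP[g0 gp] := g; have s0 := sin_gt0_pi g.
rewrite /rho_sides !gt_eqF//= angle_opposite1// angle_opposite2//.
have AB := sum_opposite_angles a0 b0 g.
have [/andP[A0 Api] _ _] := opposite_angleP b a0 g.
have [/andP[B0 Bpi] _ _] := opposite_angleP a b0 g.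
have lo := le_opposite a0 b0 g.
set A := opposite_angle a b gamma in AB A0 Api lo *.
set B := opposite_angle b a gamma in AB B0 Bpi *.
pose P := (fun m n : R => (m < a) && (n < b)).
pose f t := kern gamma t * (P (foot1 gamma l t) (foot2 gamma l t))%:R.
have mP : measurable_rel P.
  by apply: measurable_and; apply: measurable_fun_ltr.
have fi (D : set R) : measurable D -> (mu D < +oo)%E -> mu.-integrable D (EFin \o f).
  exact: integrable_chord.
have fi' (c1 c2 : bool) (x y : R) :
    mu.-integrable [set` Interval (BSide c1 x) (BSide c2 y)] (EFin \o f).
  by apply: fi => //; exact: itv_finite.
have -> : chord_density gamma l P = \int[mu]_(t in `[gamma, pi - A]) f t +
    \int[mu]_(t in `[pi - A, pi[) f t.
  rewrite /chord_density (@itv_bndbnd_setU _ _ _ (BRight (pi - A))) ?bnd_simp//=; try lra.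
  rewrite Rintegral_setU//.
  - by rewrite !Rintegral_itv_obnd_cbnd.
  - by apply: fi; [exact: measurableU|rewrite -itv_bndbnd_setU ?bnd_simp ?itv_finite//=; lra].
  - apply/disj_setPS => x [] /=; rewrite !in_itv/= => /andP[_ h] /andP[h' _].
    by move: h'; rewrite ltNge h.
have sc : sin gamma != 0 by rewrite gt_eqF.
have sinB1 t : sin (pi + gamma - t) = sin (t - gamma).
  rewrite (_ : pi + gamma - t = pi - (t - gamma)); last by ring.
  by rewrite [LHS]sinB sinpi cospi mul0r sub0r mulN1r opprK.
have sinB2 t : sin (pi + gamma - t - gamma) = sin t.
  rewrite (_ : pi + gamma - t - gamma = pi - t); last by ring.
  by rewrite [LHS]sinB sinpi cospi mul0r sub0r mulN1r opprK.
rewrite mulrDr; congr (_ + _).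
- transitivity ((sin gamma)^-1 * \int[mu]_(t in `[gamma, pi - A]) (sin gamma * f t)).
    congr (_ * _); apply: eq_Rintegral => t; rewrite inE/= in_itv/= => /andP[gt tA].
    have st0 : 0 < sin t by apply: sin_gt0_pi; apply/andP; split; lra.
    rewrite heaviside_foot// /f /kern mulrA [sin gamma * _]mulrC divfK//.
    (* at the endpoint t = gamma the kernel vanishes *)
    move: gt; rewrite le_eqVlt => /predU1P[<-|gt].
      by rewrite subrr sin0 mulr0 !mul0r.
    congr (_ * _%:R); rewrite /P /foot1 /foot2; case: ltP => //= fa; apply/esym.
    move: fa; rewrite !ltr_pdivrMr// => fa.
    have : a * sin (t - gamma) <= b * sin t by rewrite lo// gt/=; lra.
    by move=> h; rewrite (foot_transfer a0 b0 l0 h fa).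
  by rewrite RintegralZl// mulKf.
- have f0 t : pi - A <= t <= pi -> 0 <= f t.
    move=> /andP[h1 h2]; rewrite /f mulr_ge0 ?ler0n// divr_ge0 ?(ltW s0)//.
    by rewrite mulr_ge0// sin_ge0_pi//; apply/andP; split; lra.
  have mf : measurable_fun setT f by exact: measurable_chord_integrand.
  rewrite Rintegral_itv_bndo_bndc//.
  rewrite [RHS]/Rintegral (@ge0_integral_affine R (-1) (pi + gamma))//; last first.
    by apply/measurable_EFinP; exact: measurable_funTS.
  rewrite normrN1 mul1e.
  have -> : (fun x : R => -1 * x + (pi + gamma)) @^-1` `[pi - A, pi] = `[gamma, pi - B]%classic.
    by apply/seteqP; split => x /=; rewrite !in_itv/= => /andP[? ?];
      apply/andP; split; lra.
  rewrite -/(Rintegral mu `[gamma, pi - B] (fun x => f (-1 * x + (pi + gamma)))).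
  transitivity ((sin gamma)^-1 * \int[mu]_(t in `[gamma, pi - B])
      (sin gamma * f (-1 * t + (pi + gamma)))).
    congr (_ * _); apply: eq_Rintegral => t; rewrite inE/= in_itv/= => /andP[gt tB].
    have st0 : 0 < sin t by apply: sin_gt0_pi; apply/andP; split; lra.
    rewrite heaviside_foot// /f /kern mulN1r ![- t + _]addrC sinB1 sinB2.
    rewrite mulrA [sin gamma * _]mulrC divfK// [sin t * _]mulrC.
    move: gt; rewrite le_eqVlt => /predU1P[<-|gt]; first by rewrite subrr sin0 !mul0r.
    congr (_ * _%:R); rewrite /P /foot1 /foot2 sinB1 sinB2 andbC.
    case: ltP => //= fb; apply/esym.
    move: fb; rewrite !ltr_pdivrMr// => fb.
    have h : b * sin (t - gamma) <= a * sin t.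
      by rewrite le_opposite ?gt//; lra.
    by rewrite (foot_transfer b0 a0 l0 h fb).
  rewrite RintegralZl ?mulKf//.
  apply: (@integrable_bounded _ _ _ (sin gamma)^-1) => //.
  + exact: itv_finite.
  + apply: measurable_funTS; apply: (measurableT_comp mf).
    exact: measurable_affine.
  + by move=> t _; exact: chord_integrand_le.
Qed.

Lemma chord_densityB gamma l P Q : 0 < gamma < pi ->
  measurable_rel P -> measurable_rel Q ->
  (forall m n, Q m n -> P m n) ->
  chord_density gamma l P - chord_density gamma l Q =
    chord_density gamma l (fun m n => P m n && ~~ Q m n).
Proof.
move=> g mP mQ QP; rewrite /chord_density -RintegralB//; last 2 first.
- by apply: integrable_chord => //; exact: itv_finite.
- by apply: integrable_chord => //; exact: itv_finite.
apply: eq_Rintegral => t _; rewrite -mulrBr; congr (_ * _).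
have := QP (foot1 gamma l t) (foot2 gamma l t).
by case: (Q _ _) => [->//|_]; rewrite ?subrr// subr0 andbT.
Qed.

Lemma measurable_rel_lt p q :
  measurable_rel (fun m n : R => (m < p) && (n < q)).
Proof. by apply: measurable_and; apply: measurable_fun_ltr. Qed.

Lemma measurable_rel_negb P : measurable_rel P ->
  measurable_rel (fun m n : R => ~~ P m n).
Proof. by move=> mP; exact: measurable_neg. Qed.

Lemma measurable_rel_and P Q : measurable_rel P -> measurable_rel Q ->
  measurable_rel (fun m n : R => P m n && Q m n).
Proof. by move=> mP mQ; exact: measurable_and. Qed.

Lemma eq_chord_density gamma l P Q : (forall m n, P m n = Q m n) ->
  chord_density gamma l P = chord_density gamma l Q.
Proof. by move=> PQ; apply: eq_Rintegral => t _; rewrite PQ. Qed.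

(** Inclusion and exclusion on the rectangle of the distances of the two ends. *)
Lemma rho_chord_density O gamma M M' N N' l :
  0 < gamma < pi -> 0 <= l ->
  0 < dist O M' <= dist O M -> 0 < dist O N <= dist O N' ->
  rho O gamma M M' N N' l = chord_density gamma l (fun m n =>
    (dist O M' <= m < dist O M) && (dist O N <= n < dist O N')).
Proof.
move=> g l0 /andP[p0 pp'] /andP[q0 qq'].
have p'0 := lt_le_trans p0 pp'; have q'0 := lt_le_trans q0 qq'.
rewrite /rho (min_r pp') (max_l pp') (min_l qq') (max_r qq').
move: (dist O M') (dist O M) (dist O N) (dist O N') p0 p'0 q0 q'0 pp' qq'.
move=> p p' q q' p0 p'0 q0 q'0 pp' qq'.
rewrite !rho_sides_chord_density//.
have mlt := measurable_rel_lt.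
have reorder (x y z w : R) : x - y - z + w = x - y - (z - w) by ring.
rewrite reorder.
rewrite chord_densityB//; last by move=> m n /andP[mp ->]; rewrite (lt_le_trans mp pp').
rewrite chord_densityB//; last by move=> m n /andP[mp ->]; rewrite (lt_le_trans mp pp').
rewrite chord_densityB//; last 3 first.
- by apply: measurable_rel_and => //; exact: measurable_rel_negb.
- by apply: measurable_rel_and => //; exact: measurable_rel_negb.
- move=> m n /andP[/andP[-> nq]]; rewrite nq andbT (lt_le_trans nq qq')/= => h.
  by rewrite (negbTE h).
apply: eq_chord_density => m n; rewrite !leNgt.
have [nq|nq] /= := ltP n q.
  by rewrite (lt_le_trans nq qq'); case: (m < p'); case: (m < p).
by case: (m < p'); case: (m < p); case: (n < q').
Qed.
End rho_sides_density.

(** * Sets of directions of measure zero *)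

Section null_angles.
Context {R : realType}.
Local Notation mu := (@lebesgue_measure R).
Implicit Types (gamma l t p q e h : R).

Lemma finite_poly_roots (P : {poly R}) : P != 0 -> finite_set [set x | root P x].
Proof.
move=> P0; apply: contrapT => /(infinite_set_fset (size P))[B BP sB].
pose s : seq R := finmap.enum_fset B.
have rs : all (root P) s by apply/allP => x xs; apply: BP.
by have := max_poly_roots P0 rs (finmap.fset_uniq B); rewrite ltnNge sB.
Qed.

Lemma cot_inj : {in `]0, pi[ &, injective (fun t : R => cos t / sin t)}.
Proof.
have lt_cot (x y : R) : 0 < x -> y < pi -> x < y -> cos y / sin y != cos x / sin x.
  move=> x0 ypi xy.
  have sx : 0 < sin x by apply: sin_gt0_pi; rewrite x0/= (lt_trans xy).
  have sy : 0 < sin y by apply: sin_gt0_pi; rewrite ypi andbT (lt_trans x0).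
  rewrite eqr_div ?(gt_eqF sx) ?(gt_eqF sy)// lt_eqF// -subr_gt0.
  have -> : cos x * sin y - cos y * sin x = sin (y - x) by rewrite sinB; ring.
  by apply: sin_gt0_pi; rewrite subr_gt0 xy/=; lra.
move=> x y; rewrite !in_itv/= => /andP[x0 xpi] /andP[y0 ypi] exy.
have [xy|yx|//] := ltgtP x y.
- by have := lt_cot _ _ x0 ypi xy; rewrite exy eqxx.
- by have := lt_cot _ _ y0 xpi yx; rewrite exy eqxx.
Qed.

(** The cotangent is injective on ]0, pi[ and takes only finitely many values on
    the set. The point x0 is a witness that P is not the zero polynomial. *)
Lemma null_cot_roots (P : {poly R}) (x0 : R) (A : set R) : P.[x0] != 0 ->
  A `<=` [set t | 0 < t < pi /\ P.[cos t / sin t] = 0] -> mu.-negligible A.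
Proof.
move=> Px0 AP; have P0 : P != 0.
  by apply: contraNneq Px0 => ->; rewrite horner0.
apply: (@negligibleS _ (measurableTypeR R) _ mu _ _ AP); set A' := mkset _.
have fA' : finite_set A'.
  rewrite -(@eq_finite_set _ _ [set cos t / sin t | t in A']).
    apply: sub_finite_set (finite_poly_roots P0) => _ [t [_ Pt] <-] /=.
    by rewrite rootE Pt.
  apply: (@inj_card_eq _ _ A' (fun t => cos t / sin t)) => t u.
  by rewrite !inE => -[tI _] [uI _]; apply: cot_inj; rewrite in_itv.
have mA' : measurable A'.
  apply: countable_measurable; last exact: finite_set_countable.
  by move=> t; exact: measurable_set1.
apply/negligibleP => //; apply: countable_lebesgue_measure0.
exact: finite_set_countable.
Qed.

Lemma sin_cot t : 0 < t < pi -> (sin t) ^+ 2 * (1 + (cos t / sin t) ^+ 2) = 1.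
Proof.
move=> tI; have s0 := sin_gt0_pi tI.
by rewrite mulrDr mulr1 -exprMn mulrCA divff ?gt_eqF// mulr1 addrC cos2Dsin2.
Qed.

Lemma sinB_cot gamma t : 0 < t < pi ->
  sin (t - gamma) = sin t * (cos gamma - cos t / sin t * sin gamma).
Proof.
by move=> tI; have s0 := sin_gt0_pi tI; rewrite sinB; field; rewrite gt_eqF.
Qed.

(** Since sin t ^ 2 * (1 + cot t ^ 2) = 1, squaring the equation turns it into a
    polynomial equation in cot t. *)
Lemma null_foot1 gamma l p : 0 < gamma < pi -> 0 < p ->
  mu.-negligible [set t | gamma < t < pi /\ foot1 gamma l t = p].
Proof.
move=> g p0; have s0 := sin_gt0_pi g.
have ps : 0 < (p * sin gamma) ^+ 2 by rewrite exprn_gt0// mulr_gt0.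
pose P : {poly R} := ((p * sin gamma) ^+ 2)%:P * (1 + 'X ^+ 2) - (l ^+ 2)%:P.
have PE x : P.[x] = (p * sin gamma) ^+ 2 * (1 + x ^+ 2) - l ^+ 2.
  by rewrite /P !hornerE.
have [x Px] : exists x, P.[x] != 0.
  have [h|h] := eqVneq P.[0] 0; last by exists 0.
  by exists 1; rewrite PE gt_eqF//; move: h; rewrite PE; lra.
apply: null_cot_roots Px _ => t [/andP[gt tpi] ft] /=.
have tI : 0 < t < pi by rewrite tpi andbT (lt_trans _ gt)//; case/andP: g.
split=> //; rewrite PE -ft /foot1 divfK ?(gt_eqF s0)//.
by rewrite exprMn -mulrA sin_cot// mulr1 subrr.
Qed.

Lemma null_foot2 gamma l q : 0 < gamma < pi -> 0 < q ->
  mu.-negligible [set t | gamma < t < pi /\ foot2 gamma l t = q].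
Proof.
move=> g q0; have s0 := sin_gt0_pi g.
have qs : 0 < (q * sin gamma) ^+ 2 by rewrite exprn_gt0// mulr_gt0.
pose P : {poly R} := ((q * sin gamma) ^+ 2)%:P * (1 + 'X ^+ 2)
   - (l ^+ 2)%:P * ((cos gamma)%:P - 'X * (sin gamma)%:P) ^+ 2.
have PE x : P.[x] = (q * sin gamma) ^+ 2 * (1 + x ^+ 2)
    - l ^+ 2 * (cos gamma - x * sin gamma) ^+ 2.
  by rewrite /P !hornerE.
have Px : P.[cos gamma / sin gamma] != 0.
  rewrite PE divfK ?(gt_eqF s0)// subrr expr0n/= mulr0 subr0 gt_eqF//.
  by rewrite mulr_gt0// ltr_pwDl ?sqr_ge0.
apply: null_cot_roots Px _ => t [/andP[gt tpi] ft] /=.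
have tI : 0 < t < pi by rewrite tpi andbT (lt_trans _ gt)//; case/andP: g.
split=> //; rewrite PE -ft /foot2 divfK ?(gt_eqF s0)//.
rewrite sinB_cot// !exprMn.
transitivity (l ^+ 2 * (cos gamma - cos t / sin t * sin gamma) ^+ 2 *
  (sin t ^+ 2 * (1 + (cos t / sin t) ^+ 2) - 1)); first by ring.
by rewrite sin_cot// subrr mulr0.
Qed.

(** The equation says that the chord passes through the point with coordinates e
    and h along the two half-lines. Divided by sin t it contains sin t in a
    single term; squared, it is a polynomial equation of degree 4 in cot t. It
    fails at cot gamma because h is positive. *)
Lemma null_vertex gamma l e h : 0 < gamma < pi -> 0 < l -> 0 < h ->
  mu.-negligible [set t | gamma < t < pi /\
    foot1 gamma l t * foot2 gamma l t =
    e * foot2 gamma l t + h * foot1 gamma l t].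
Proof.
move=> g l0 h0; have s0 := sin_gt0_pi g.
pose P : {poly R} := ((sin gamma) ^+ 2)%:P *
   (e%:P * ((cos gamma)%:P - 'X * (sin gamma)%:P) + h%:P) ^+ 2 * (1 + 'X ^+ 2)
   - (l ^+ 2)%:P * ((cos gamma)%:P - 'X * (sin gamma)%:P) ^+ 2.
have PE x : P.[x] = (sin gamma) ^+ 2 *
    (e * (cos gamma - x * sin gamma) + h) ^+ 2 * (1 + x ^+ 2)
    - l ^+ 2 * (cos gamma - x * sin gamma) ^+ 2.
  by rewrite /P !hornerE.
have Px : P.[cos gamma / sin gamma] != 0.
  rewrite PE divfK ?(gt_eqF s0)// subrr expr0n/= !mulr0 subr0 add0r gt_eqF//.
  by rewrite !mulr_gt0 ?exprn_gt0// ltr_pwDl ?sqr_ge0.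
apply: null_cot_roots Px _ => t [/andP[gt tpi] ft] /=.
have tI : 0 < t < pi by rewrite tpi andbT (lt_trans _ gt)//; case/andP: g.
split=> //; rewrite PE.
have st := sin_gt0_pi tI.
set T := cos t / sin t; pose w := cos gamma - T * sin gamma.
have ew : sin gamma * (e * w + h) = l * sin t * w.
  move: ft; rewrite /foot1 /foot2 sinB_cot// -/T -/w => ft.
  have k0 : l * sin t / sin gamma != 0 by rewrite gt_eqF// divr_gt0// mulr_gt0.
  apply: (mulfI k0); apply: (mulIf (lt0r_neq0 (divr_gt0 ltr01 s0))).
  transitivity ((e * (l * (sin t * w) / sin gamma) + h * (l * sin t / sin gamma))).
    by field; rewrite gt_eqF.
  by rewrite -ft; field; rewrite gt_eqF.
rewrite -/w -exprMn ew.
transitivity (l ^+ 2 * w ^+ 2 * (sin t ^+ 2 * (1 + T ^+ 2) - 1)); first by ring.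
by rewrite sin_cot// subrr mulr0.
Qed.

End null_angles.

(** * Continuity of the density of the chords below a point *)

Section convergence_of_densities.
Context {R : realType}.
Local Notation mu := (@lebesgue_measure R).
Implicit Types (gamma l t : R) (P Q : R -> R -> bool).

(** Dominated convergence: the kernel is bounded by 1 / sin gamma. *)
Lemma chord_density_cvg gamma (l_ : R^nat) l (P_ : nat -> R -> R -> bool) P
    (N : set R) :
  0 < gamma < pi -> (forall n, measurable_rel (P_ n)) -> measurable_rel P ->
  mu.-negligible N ->
  (forall t, gamma < t < pi -> ~ N t -> \forall n \near \oo,
     P_ n (foot1 gamma (l_ n) t) (foot2 gamma (l_ n) t) =
     P (foot1 gamma l t) (foot2 gamma l t)) ->
  chord_density gamma (l_ n) (P_ n) @[n --> \oo] --> chord_density gamma l P.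
Proof.
move=> g mP_ mP N0 PP.
pose f_ n t := (kern gamma t *
  (P_ n (foot1 gamma (l_ n) t) (foot2 gamma (l_ n) t))%:R)%:E.
pose f t := (kern gamma t * (P (foot1 gamma l t) (foot2 gamma l t))%:R)%:E.
have fin b1 b2 := @itv_finite R b1 b2 gamma pi.
have fi : mu.-integrable `]gamma, pi[ f by exact: integrable_chord.
have [] := @dominated_convergence _ _ R mu `]gamma, pi[ (measurable_itv _)
  f_ f (cst (sin gamma)^-1%:E).
- by move=> n; apply/measurable_EFinP; exact: measurable_chord_integrand.
- by apply/measurable_EFinP; exact: measurable_chord_integrand.
- apply: (@negligibleS _ (measurableTypeR R) _ mu _ _ _ N0) => t /= h.
  apply: contrapT => Nt; apply: h => tI.
  apply: cvg_near_cst; rewrite /= in_itv/= in tI.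
  have := PP t tI Nt; apply: filterS => n; rewrite /f_ /f => ->.
  by [].
- apply/integrableP; split=> //.
  rewrite /= integral_cst//=; apply: lte_mul_pinfty => //.
- apply: aeW => t n _; rewrite /= lee_fin; exact: chord_integrand_le.
move=> _ _ h; rewrite /chord_density/Rintegral.
apply: fine_cvg; rewrite fineK//.
exact: integrable_fin_num.
Qed.

Lemma near_le (u v : R^nat) (x y : R) : u @ \oo --> x -> v @ \oo --> y ->
  x != y -> \forall n \near \oo, (u n <= v n) = (x <= y) /\ (u n < v n) = (x < y).
Proof.
move=> ux vy; case: ltgtP => // xy _.
- have h : \forall n \near \oo, u n < v n.
    have yx0 : 0 < y - x by rewrite subr_gt0.
    apply: filterS (cvgr_gt (y - x) (cvgB vy ux) _ yx0) => n.
    by rewrite -[X in X -> _]/(is_true (0 < _ - _)) subr_gt0.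
  by apply: filterS h => n h; rewrite h ltW.
- have h : \forall n \near \oo, v n < u n.
    have xy0 : 0 < x - y by rewrite subr_gt0.
    apply: filterS (cvgr_gt (x - y) (cvgB ux vy) _ xy0) => n.
    by rewrite -[X in X -> _]/(is_true (0 < _ - _)) subr_gt0.
  by apply: filterS h => n h; rewrite (lt_geF h) (lt_gtF h).
Qed.

Section under_vertex.
Variables (gamma a b c e h : R).
Hypotheses (g : 0 < gamma < pi) (b0 : 0 < b) (a0 : 0 < a) (c0 : 0 < c) (h0 : 0 < h).

(** In coordinates along the two half-lines the chord with ends m and n is the
    line x / m + y / n = 1, so the point (e, h) lies strictly beyond it, as seen
    from O, when e / m + h / n > 1. The interval of m is half-open so that it is
    partitioned by the intervals of a subdivision. *)
Definition under_vertex : R -> R -> bool := fun m n =>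
  [&& b <= m, m < a, c <= n & m * n < e * n + h * m].

Lemma measurable_under_vertex : measurable_rel under_vertex.
Proof.
apply: measurable_and; first exact: measurable_fun_ler.
apply: measurable_and; first exact: measurable_fun_ltr.
apply: measurable_and; first exact: measurable_fun_ler.
apply: measurable_fun_ltr; first exact: measurable_funM.
by apply: measurable_funD; exact: measurable_funM.
Qed.

(** The directions for which the chord of length l lies on the boundary of the
    condition; elsewhere the condition is locally constant in all its data. *)
Definition critical_angles l : set R :=
  [set t | gamma < t < pi /\ foot1 gamma l t = b] `|`
  [set t | gamma < t < pi /\ foot1 gamma l t = a] `|`
  [set t | gamma < t < pi /\ foot2 gamma l t = c] `|`
  [set t | gamma < t < pi /\ foot1 gamma l t * foot2 gamma l t =
    e * foot2 gamma l t + h * foot1 gamma l t].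

Lemma null_critical_angles l : 0 < l -> mu.-negligible (critical_angles l).
Proof.
move=> l0; apply: negligibleU; last exact: null_vertex.
apply: negligibleU; last exact: null_foot2.
by apply: negligibleU; exact: null_foot1.
Qed.

Lemma continuous_under_vertex_density l : 0 < l ->
  {for l, continuous (fun l => chord_density gamma l under_vertex)}.
Proof.
move=> l0; apply/(@cvg_nbhsP _ R^o) => l_ ll.
apply: (chord_density_cvg g _ _ (null_critical_angles l0)).
- by move=> _; exact: measurable_under_vertex.
- exact: measurable_under_vertex.
move=> t tI nc.
have f1 : foot1 gamma (l_ n) t @[n --> \oo] --> foot1 gamma l t.
  by apply: cvgM; [apply: cvgM => //; exact: cvg_cst|exact: cvg_cst].
have f2 : foot2 gamma (l_ n) t @[n --> \oo] --> foot2 gamma l t.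
  by apply: cvgM; [apply: cvgM => //; exact: cvg_cst|exact: cvg_cst].
have mb : b != foot1 gamma l t.
  by apply/eqP => E; apply: nc; left; left; left.
have ma : foot1 gamma l t != a.
  by apply/eqP => E; apply: nc; left; left; right.
have nc' : c != foot2 gamma l t.
  by apply/eqP => E; apply: nc; left; right.
have nv : foot1 gamma l t * foot2 gamma l t !=
    e * foot2 gamma l t + h * foot1 gamma l t.
  by apply/eqP => E; apply: nc; right.
have h1 : \forall n \near \oo, (b <= foot1 gamma (l_ n) t) = (b <= foot1 gamma l t).
  by apply: filterS (near_le (cvg_cst b) f1 mb) => n [].
have h2 : \forall n \near \oo, (foot1 gamma (l_ n) t < a) = (foot1 gamma l t < a).
  by apply: filterS (near_le f1 (cvg_cst a) ma) => n [].
have h3 : \forall n \near \oo, (c <= foot2 gamma (l_ n) t) = (c <= foot2 gamma l t).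
  by apply: filterS (near_le (cvg_cst c) f2 nc') => n [].
have h4 : \forall n \near \oo,
    (foot1 gamma (l_ n) t * foot2 gamma (l_ n) t <
      e * foot2 gamma (l_ n) t + h * foot1 gamma (l_ n) t) =
    (foot1 gamma l t * foot2 gamma l t <
      e * foot2 gamma l t + h * foot1 gamma l t).
  by apply: filterS (near_le (cvgM f1 f2)
    (cvgD (cvgM (cvg_cst e) f2) (cvgM (cvg_cst h) f1)) nv) => n [].
apply: filterS2 (filterI h1 h2) (filterI h3 h4) => n [E1 E2] [E3 E4].
by rewrite /under_vertex E1 E2 E3 E4.
Qed.

End under_vertex.
End convergence_of_densities.

(** * Staircases below and above the curve of opposite points *)

Section staircases.
Context {R : realType}.
Local Notation mu := (@lebesgue_measure R).
Implicit Types (gamma l t m k : R) (P Q : R -> R -> bool).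

Lemma le_chord_density gamma l P Q : 0 < gamma < pi ->
  measurable_rel P -> measurable_rel Q -> (forall m k, P m k -> Q m k) ->
  chord_density gamma l P <= chord_density gamma l Q.
Proof.
move=> g mP mQ PQ; apply: le_Rintegral => //.
- by apply: integrable_chord => //; exact: itv_finite.
- by apply: integrable_chord => //; exact: itv_finite.
move=> t /=; rewrite in_itv/= => tI; rewrite ler_wpM2l ?(ltW (kern_gt0 g tI))//.
by have := PQ (foot1 gamma l t) (foot2 gamma l t); case: (P _ _) => [->//|_];
  case: (Q _ _).
Qed.

Lemma measurable_rel_has (cell : nat -> R -> R -> bool) (s : seq nat) :
  (forall i, measurable_rel (cell i)) ->
  measurable_rel (fun m k => has (fun i => cell i m k) s).
Proof.
move=> mc; elim: s => [|i s IH] /=; first exact: measurable_cst.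
by apply: measurable_or; [exact: mc|exact: IH].
Qed.

Lemma chord_density0 gamma l : chord_density gamma l (fun _ _ => false) = 0.
Proof.
rewrite /chord_density /Rintegral; under eq_integral do rewrite mulr0.
by rewrite integral0.
Qed.

Lemma sum_chord_density gamma l (cell : nat -> R -> R -> bool) n :
  0 < gamma < pi -> (forall i, measurable_rel (cell i)) ->
  (forall i j m k, (i < j <= n)%N -> cell i m k -> ~~ cell j m k) ->
  \sum_(1 <= i < n.+1) chord_density gamma l (cell i) =
  chord_density gamma l (fun m k => has (fun i => cell i m k) (index_iota 1 n.+1)).
Proof.
move=> g mc; elim: n => [|n IH] dis.
  by rewrite big_geq// chord_density0.
rewrite big_nat_recr//= IH; last first.
  by move=> i j m k /andP[ij jn]; apply: dis; rewrite ij ltnW.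
pose C m k := has (fun i => cell i m k) (index_iota 1 n.+1).
pose A m k := has (fun i => cell i m k) (index_iota 1 n.+2).
have AE m k : A m k = C m k || cell n.+1 m k.
  rewrite /A /C /index_iota !subSS !subn0 -[in iota 1 n.+1](addn1 n) iotaD has_cat.
  by rewrite has_seq1 add1n.
have mA : measurable_rel A by exact: measurable_rel_has.
have mC : measurable_rel C by exact: measurable_rel_has.
have CA m k : C m k -> A m k by move=> Cmk; rewrite AE Cmk.
suff : chord_density gamma l A - chord_density gamma l C =
    chord_density gamma l (cell n.+1).
  by move/eqP; rewrite subr_eq addrC => /eqP/esym.
rewrite chord_densityB//; apply: eq_chord_density => m k; rewrite AE.
case: (boolP (C m k)) => [/hasP[i]|_] /=; last by rewrite andbT.
rewrite mem_index_iota => /andP[_ i_n] ci; apply/esym/negbTE.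
by apply: dis ci; rewrite i_n /=.
Qed.

Variables (a b c e h : R).
Hypotheses (e0 : 0 < e) (eb : e < b) (ba : b < a) (c0 : 0 < c) (h0 : 0 < h).
Local Notation under := (under_vertex a b c e h).

(** The distance from O of the second end of the chord through the point (e, h)
    whose first end is at distance s. *)
Definition opposite s : R := h * s / (s - e).

Lemma lt_opposite s k : e < s -> (k < opposite s) = (s * k < e * k + h * s).
Proof.
move=> es; rewrite /opposite ltr_pdivlMr ?subr_gt0//.
by rewrite mulrBr ltrBlDl (mulrC k) (mulrC k).
Qed.

Lemma opposite_anti s s' k : e < s -> s <= s' -> 0 < k ->
  k < opposite s' -> k < opposite s.
Proof.
move=> es ss' k0; rewrite !lt_opposite ?(lt_le_trans es)// => hs.
have [kh|hk] := leP k h.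
  rewrite (@le_lt_trans _ _ (h * s))// ?ltrDr ?mulr_gt0//.
  by rewrite mulrC ler_wpM2r// (le_trans _ (ltW es))// ltW.
have : (k - h) * s <= (k - h) * s' by rewrite ler_wpM2l// subr_ge0 ltW.
move: hs; lra.
Qed.

Definition step n i : R := a - i%:R / n%:R * (a - b).

Definition upper_cell n i m k :=
  (step n i <= m < step n i.-1) && (c <= k < opposite (step n i)).

Definition lower_cell n i m k :=
  (step n i <= m < step n i.-1) && (c <= k < opposite (step n i.-1)).

Definition upper_stair n m k := has (fun i => upper_cell n i m k) (index_iota 1 n.+1).

Definition lower_stair n m k := has (fun i => lower_cell n i m k) (index_iota 1 n.+1).

Lemma step0 n : step n 0 = a. Proof. by rewrite /step !mul0r subr0. Qed.

Lemma stepn n : (0 < n)%N -> step n n = b.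
Proof. by move=> n0; rewrite /step divff ?mul1r ?pnatr_eq0 -?lt0n//; lra. Qed.

Lemma step_anti n i j : (i <= j)%N -> step n j <= step n i.
Proof.
move=> ij; rewrite lerD2l lerN2 ler_wpM2r ?subr_ge0 ?(ltW ba)//.
by rewrite ler_wpM2r ?invr_ge0 ?ler0n// ler_nat.
Qed.

Lemma le_step_b n i : (0 < n)%N -> (i <= n)%N -> b <= step n i.
Proof. by move=> n0 ni; rewrite -(stepn n0) step_anti. Qed.

Lemma le_step_a n i : step n i <= a.
Proof. by rewrite -(step0 n) step_anti. Qed.

Lemma step_pred n i : (0 < i)%N -> step n i.-1 = step n i + (a - b) / n%:R.
Proof. by case: i => // i _; rewrite /step /= -natr1; ring. Qed.

Lemma lower_stair_under n m k : (0 < n)%N -> lower_stair n m k -> under m k.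
Proof.
move=> n0 /hasP[i]; rewrite mem_index_iota ltnS => /andP[i1 i_n].
move=> /andP[/andP[sm ms] /andP[ck ks]].
have bm : b <= m by rewrite (le_trans _ sm)// le_step_b.
have k0 := lt_le_trans c0 ck; have em := lt_le_trans eb bm.
rewrite /under_vertex bm ck (lt_le_trans ms) ?le_step_a//=.
by rewrite -lt_opposite//; apply: opposite_anti ks => //; exact: ltW.
Qed.

(** The cell is found from the least i with step n i <= m. *)
Lemma step_cell n m : (0 < n)%N -> b <= m < a ->
  exists2 i, i \in index_iota 1 n.+1 & step n i <= m < step n i.-1.
Proof.
move=> n0 /andP[bm ma].
have ex : exists i, step n i <= m by exists n; rewrite stepn.
have := ex_minnP ex; case: ex_minnP => // i si imin _.
exists i; first rewrite mem_index_iota ltnS.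
  rewrite lt0n imin ?stepn// andbT; apply: contraTneq si => ->.
  by rewrite step0 -ltNge.
rewrite si ltNge; apply/negP => /imin.
case: i si {imin} => [|i _]; first by rewrite step0 leNgt ma.
by rewrite ltnn.
Qed.

Lemma under_upper_stair n m k : (0 < n)%N -> under m k -> upper_stair n m k.
Proof.
move=> n0 /and4P[bm ma ck mk]; have bma : b <= m < a by rewrite bm ma.
have [i iI /andP[sm ms]] := step_cell n0 bma.
apply/hasP; exists i => //; rewrite /upper_cell sm ms ck/=.
have k0 := lt_le_trans c0 ck; have em := lt_le_trans eb bm.
apply: (opposite_anti _ sm) => //; last by rewrite lt_opposite.
apply: (lt_le_trans eb); apply: le_step_b => //.
by move: iI; rewrite mem_index_iota ltnS => /andP[].
Qed.

(** The condition k < opposite s is affine in s with slope h - k, and on a cell s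
    differs from m by at most (a - b) / n. When (m, k) is off the curve and n is
    large, the condition cannot change within the cell. *)
Lemma stair_near n m k : (0 < n)%N ->
  `|h - k| * (a - b) < `|e * k + h * m - m * k| * n%:R ->
  lower_stair n m k = under m k /\ upper_stair n m k = under m k.
Proof.
move=> n0 large; have nR : 0 < n%:R :> R by rewrite ltr0n.
have {}large : `|h - k| * ((a - b) / n%:R) < `|e * k + h * m - m * k|.
  by rewrite mulrA ltr_pdivrMr.
have close s : `|s - m| <= (a - b) / n%:R ->
    `|(h - k) * (s - m)| < `|e * k + h * m - m * k|.
  by move=> sm; rewrite normrM (le_lt_trans _ large)// ler_wpM2l.
have same s : e < s -> `|s - m| <= (a - b) / n%:R ->
    (k < opposite s) = (m * k < e * k + h * m).
  move=> es /close; rewrite lt_opposite// => cl.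
  rewrite -[in LHS]subr_gt0 -[in RHS]subr_gt0.
  have -> : e * k + h * s - s * k =
    (e * k + h * m - m * k) + (h - k) * (s - m) by ring.
  move: cl; set x := e * k + _ - _; set y := _ * (s - m).
  by case: (ler0P y) => y0; case: (ler0P x) => x0 xy; apply/idP/idP; lra.
have UU : upper_stair n m k -> under m k.
  move=> /hasP[i]; rewrite mem_index_iota ltnS => /andP[i1 i_n].
  move=> /andP[/andP[sm ms] /andP[ck ks]].
  have bm : b <= m by rewrite (le_trans _ sm)// le_step_b.
  rewrite /under_vertex bm ck (lt_le_trans ms) ?le_step_a//=.
  rewrite -(same (step n i))// ?(lt_le_trans eb) ?le_step_b//.
  rewrite step_pred// in ms; rewrite ler0_norm ?subr_le0//; lra.
have UL : under m k -> lower_stair n m k.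
  move=> /and4P[bm ma ck mk]; have bma : b <= m < a by rewrite bm ma.
  have [i iI /andP[sm ms]] := step_cell n0 bma.
  apply/hasP; exists i => //; rewrite /lower_cell sm ms ck/=.
  move: iI; rewrite mem_index_iota ltnS => /andP[i1 i_n].
  rewrite same ?(lt_le_trans eb) ?le_step_b// ?(leq_trans (leq_pred _))//.
  rewrite ger0_norm ?subr_ge0 ?(ltW ms)// step_pred//; lra.
split; apply/idP/idP => //.
- exact: lower_stair_under.
- exact: under_upper_stair.
Qed.

End staircases.

(** * Convergence of the staircases *)

Section staircase_densities.
Context {R : realType}.
Variables (gamma l a b c e h : R).
Hypotheses (g : 0 < gamma < pi) (l0 : 0 < l).
Hypotheses (e0 : 0 < e) (eb : e < b) (ba : b < a) (c0 : 0 < c) (h0 : 0 < h).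
Local Notation under := (under_vertex a b c e h).
Local Notation upper_cell := (upper_cell a b c e h).
Local Notation lower_cell := (lower_cell a b c e h).
Local Notation upper_stair := (upper_stair a b c e h).
Local Notation lower_stair := (lower_stair a b c e h).

Lemma measurable_rel_cell (p p' q q' : R) :
  measurable_rel (fun m k => (p <= m < p') && (q <= k < q')).
Proof.
by apply: measurable_rel_and; apply: measurable_and;
  by [exact: measurable_fun_ler|exact: measurable_fun_ltr].
Qed.

Let stepE n i j m : (i < j)%N -> step a b n i <= m -> ~~ (m < step a b n j.-1).
Proof.
move=> ij im; rewrite -leNgt (le_trans _ im)// step_anti//.
by case: j ij.
Qed.

Lemma sum_upper_cells n :
  \sum_(1 <= i < n.+1) chord_density gamma l (upper_cell n i) =
  chord_density gamma l (upper_stair n).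
Proof.
apply: sum_chord_density => // [i|i j m k /andP[ij _]].
  exact: measurable_rel_cell.
move=> /andP[/andP[im _] _]; apply/negP => /andP[/andP[_ mj] _].
by have := stepE ij im; rewrite mj.
Qed.

Lemma sum_lower_cells n :
  \sum_(1 <= i < n.+1) chord_density gamma l (lower_cell n i) =
  chord_density gamma l (lower_stair n).
Proof.
apply: sum_chord_density => // [i|i j m k /andP[ij _]].
  exact: measurable_rel_cell.
move=> /andP[/andP[im _] _]; apply/negP => /andP[/andP[_ mj] _].
by have := stepE ij im; rewrite mj.
Qed.

Lemma measurable_upper_stair n : measurable_rel (upper_stair n).
Proof. by apply: measurable_rel_has => i; exact: measurable_rel_cell. Qed.

Lemma measurable_lower_stair n : measurable_rel (lower_stair n).
Proof. by apply: measurable_rel_has => i; exact: measurable_rel_cell. Qed.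

Lemma lower_stair_density_le n : (0 < n)%N ->
  chord_density gamma l (lower_stair n) <= chord_density gamma l under.
Proof.
move=> n0; apply: le_chord_density => //.
- exact: measurable_lower_stair.
- exact: measurable_under_vertex.
- by move=> m k; exact: lower_stair_under.
Qed.

Lemma upper_stair_density_ge n : (0 < n)%N ->
  chord_density gamma l under <= chord_density gamma l (upper_stair n).
Proof.
move=> n0; apply: le_chord_density => //.
- exact: measurable_under_vertex.
- exact: measurable_upper_stair.
- by move=> m k; exact: under_upper_stair.
Qed.

Let b0 : 0 < b. Proof. exact: lt_trans eb. Qed.
Let a0 : 0 < a. Proof. exact: lt_trans ba. Qed.

Lemma near_stair t : gamma < t < pi -> ~ critical_angles gamma a b c e h l t ->
  let m := foot1 gamma l t in let k := foot2 gamma l t in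
  \forall n \near \oo,
    lower_stair n m k = under m k /\ upper_stair n m k = under m k.
Proof.
move=> tI nc m k.
have d0 : 0 < `|e * k + h * m - m * k|.
  rewrite normr_gt0 subr_eq0; apply/eqP => E; apply: nc.
  by right; split => //; rewrite -E.
near=> n.
have n0 : (0 < n)%N by near: n; exact: nbhs_infty_gt.
apply: stair_near => //; rewrite mulrC -ltr_pdivrMl//.
by near: n; exact: nbhs_infty_gtr.
Unshelve. all: by end_near. Qed.

Lemma cvg_lower_stair_density :
  chord_density gamma l (lower_stair n) @[n --> \oo] --> chord_density gamma l under.
Proof.
apply: (chord_density_cvg g _ _ (null_critical_angles e g b0 a0 c0 h0 l0)).
- by move=> n; exact: measurable_lower_stair.
- exact: measurable_under_vertex.
by move=> t tI nc; apply: filterS (near_stair tI nc) => n [].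
Qed.

Lemma cvg_upper_stair_density :
  chord_density gamma l (upper_stair n) @[n --> \oo] --> chord_density gamma l under.
Proof.
apply: (chord_density_cvg g _ _ (null_critical_angles e g b0 a0 c0 h0 l0)).
- by move=> n; exact: measurable_upper_stair.
- exact: measurable_under_vertex.
by move=> t tI nc; apply: filterS (near_stair tI nc) => n [].
Qed.

End staircase_densities.

(** * Oblique coordinates in the quadrilateral *)

Section oblique_coordinates.
Context {R : realType}.
Implicit Types (O U W P Q : R * R) (x y m n : R).

Definition cross U W : R := U.1 * W.2 - U.2 * W.1.

Definition pt O U W x y : R * R := O + x *: U + y *: W.

Lemma pt1 O U W x y : (pt O U W x y).1 = O.1 + x * U.1 + y * W.1.
Proof. by []. Qed.

Lemma pt2 O U W x y : (pt O U W x y).2 = O.2 + x * U.2 + y * W.2.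
Proof. by []. Qed.

Lemma eq_pair P Q : P.1 = Q.1 -> P.2 = Q.2 -> P = Q.
Proof. by case: P Q => [? ?] [? ?] /= -> ->. Qed.

Lemma affine1 P Q x : (P + x *: Q).1 = P.1 + x * Q.1. Proof. by []. Qed.
Lemma affine2 P Q x : (P + x *: Q).2 = P.2 + x * Q.2. Proof. by []. Qed.
Lemma fstB P Q : (P - Q).1 = P.1 - Q.1. Proof. by []. Qed.
Lemma sndB P Q : (P - Q).2 = P.2 - Q.2. Proof. by []. Qed.

Lemma cross_free U W x y : cross U W != 0 ->
  x * U.1 + y * W.1 = 0 -> x * U.2 + y * W.2 = 0 -> x = 0 /\ y = 0.
Proof.
move=> D0 e1 e2; split; apply: (mulIf D0); rewrite mul0r /cross.
- transitivity ((x * U.1 + y * W.1) * W.2 - (x * U.2 + y * W.2) * W.1); first by ring.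
  by rewrite e1 e2 !mul0r subrr.
- transitivity (U.1 * (x * U.2 + y * W.2) - U.2 * (x * U.1 + y * W.1)); first by ring.
  by rewrite e1 e2 !mulr0 subrr.
Qed.

Lemma pt_inj O U W x y x' y' : cross U W != 0 ->
  pt O U W x y = pt O U W x' y' -> x = x' /\ y = y'.
Proof.
move=> D0 E; have [] := @cross_free U W (x - x') (y - y') D0.
- by have := congr1 fst E; rewrite !pt1; lra.
- by have := congr1 snd E; rewrite !pt2; lra.
- by move=> /eqP; rewrite subr_eq0 => /eqP -> /eqP; rewrite subr_eq0 => /eqP ->.
Qed.

Lemma pt_surj O U W P : cross U W != 0 -> exists x y, P = pt O U W x y.
Proof.
move=> D0; exists (cross (P - O) W / cross U W), (cross U (P - O) / cross U W).
by apply: eq_pair; rewrite ?pt1 ?pt2 /cross/= in D0 *; field.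
Qed.

Lemma pt_segment O U W x y x' y' t :
  pt O U W x y + t *: (pt O U W x' y' - pt O U W x y) =
  pt O U W (x + t * (x' - x)) (y + t * (y' - y)).
Proof.
by apply: eq_pair; rewrite ?affine1 ?affine2 ?fstB ?sndB ?pt1 ?pt2; ring.
Qed.

Lemma pt_triangle O U W x y x1 y1 x2 y2 : cross U W != 0 ->
  triangle O (pt O U W x1 y1) (pt O U W x2 y2) (pt O U W x y) <->
  exists s t, [/\ 0 <= s, 0 <= t, s + t <= 1, x = s * x1 + t * x2 & y = s * y1 + t * y2].
Proof.
move=> D0; split.
- move=> [r [s [t [r0 s0 t0 rst E]]]]; exists s, t.
  have E' : pt O U W x y = pt O U W (s * x1 + t * x2) (s * y1 + t * y2).
    rewrite E (_ : r = 1 - s - t); last by lra.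
    by apply: eq_pair; rewrite ?pt1 ?pt2/=; 
      rewrite -![_ *: _]/(_ * _) ?pt1 ?pt2; ring.
  have [-> ->] := pt_inj D0 E'; split=> //; lra.
- move=> [s [t [s0 t0 st -> ->]]]; exists (1 - s - t), s, t.
  split=> //; first lra.
    by lra.
  by apply: eq_pair; rewrite ?pt1 ?pt2/=; 
      rewrite -![_ *: _]/(_ * _) ?pt1 ?pt2; ring.
Qed.

Section concave.
Variables (O A V D : R * R).
Hypothesis hquad : concave_quadrilateral O A V D.
Let U := A - O.
Let W := D - O.

(** The four turns are the cross product of the two sides at O multiplied by 1,
    w, v + w - 1 and v. *)
Lemma concave_coordinates : cross U W != 0 /\
  exists v w, [/\ V = pt O U W v w, 0 < v, 0 < w & v + w < 1].
Proof.
have D0 : cross U W != 0.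
  by case: hquad => -[h _ _ _]; move: h; rewrite /turn /cross /U /W !fstB !sndB;
  [rewrite neq_lt => h; apply/orP; right|rewrite neq_lt => h; apply/orP; left]; lra.
split=> //; have [v [w VE]] := pt_surj O V D0.
exists v, w.
have t1 : turn D O A = cross U W by rewrite /turn /cross /U /W /=; ring.
have t2 : turn O A V = w * cross U W.
  by rewrite VE /turn /cross pt1 pt2 /U /W /=; ring.
have t3 : turn V D O = v * cross U W.
  by rewrite VE /turn /cross pt1 pt2 /U /W /=; ring.
have t4 : turn A V D = (v + w - 1) * cross U W.
  by rewrite VE /turn /cross pt1 pt2 /U /W /=; ring.
move: hquad; rewrite /concave_quadrilateral t1 t2 t3 t4.
case=> -[h1 h2 h3 h4]; split=> //.
- by rewrite pmulr_lgt0 in h4.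
- by rewrite pmulr_lgt0 in h2.
- by rewrite pmulr_llt0// in h3; lra.
- by rewrite nmulr_llt0 in h4.
- by rewrite nmulr_llt0 in h2.
- by rewrite nmulr_lgt0// in h3; lra.
Qed.

End concave.

Section reflex_vertex.
Variables (O A V D : R * R) (v w : R).
Let U := A - O.
Let W := D - O.
Local Notation pt := (pt O U W).
Hypotheses (D0 : cross U W != 0) (VE : V = pt v w).
Hypotheses (v0 : 0 < v) (w0 : 0 < w) (vw : v + w < 1).

Lemma ptO : O = pt 0 0.
Proof. by apply: eq_pair; rewrite ?pt1 ?pt2; ring. Qed.

Lemma ptA : A = pt 1 0.
Proof. by apply: eq_pair; rewrite ?pt1 ?pt2 /U /=; ring. Qed.

Lemma ptD : D = pt 0 1.
Proof. by apply: eq_pair; rewrite ?pt1 ?pt2 /W /=; ring. Qed.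

(** The coordinates of B along OA and of C along OD. *)
Definition beta : R := v / (1 - w).
Definition kappa : R := w / (1 - v).

Let w1 : 0 < 1 - w. Proof. by move: v0 vw; lra. Qed.
Let v1 : 0 < 1 - v. Proof. by move: w0 vw; lra. Qed.

Lemma beta_gtv : v < beta.
Proof. by rewrite /beta ltr_pdivlMr// mulrBr mulr1 gtrBl mulr_gt0. Qed.

Lemma beta_lt1 : beta < 1.
Proof. by rewrite /beta ltr_pdivrMr// mul1r; move: vw; lra. Qed.

Lemma kappa_gtw : w < kappa.
Proof. by rewrite /kappa ltr_pdivlMr// mulrBr mulr1 gtrBl mulr_gt0. Qed.

Lemma kappa_lt1 : kappa < 1.
Proof. by rewrite /kappa ltr_pdivrMr// mul1r; move: vw; lra. Qed.

Lemma pt_on_line x y x' y' P : line (pt x y) (pt x' y') P ->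
  exists t, P = pt (x + t * (x' - x)) (y + t * (y' - y)).
Proof. by move=> [t _ <-]; exists t; rewrite pt_segment. Qed.

Lemma pt_on_segment x y x' y' P : segment (pt x y) (pt x' y') P <->
  exists2 t, 0 <= t <= 1 & P = pt (x + t * (x' - x)) (y + t * (y' - y)).
Proof.
split; first by move=> [t /=]; rewrite in_itv/= => tI <-; exists t; rewrite ?pt_segment.
by move=> [t tI ->]; exists t; rewrite /= ?in_itv//= pt_segment.
Qed.

Lemma B_coordinates B : segment O A B -> line D V B -> B = pt beta 0.
Proof.
rewrite [in segment O]ptO ptA ptD VE => /pt_on_segment[t _ ->] /pt_on_line[s].
move=> /(pt_inj D0)[e1 e2].
have se : s = (1 - w)^-1.
  apply: (mulIf (lt0r_neq0 w1)); rewrite mulVf ?lt0r_neq0//; lra.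
have -> : 0 + t * (0 - 0) = 0 :> R by ring.
by rewrite e1 se /beta; congr pt; ring.
Qed.

Lemma C_coordinates C : segment O D C -> line A V C -> C = pt 0 kappa.
Proof.
rewrite [in segment O]ptO ptA ptD VE => /pt_on_segment[t _ ->] /pt_on_line[s].
move=> /(pt_inj D0)[e1 e2].
have se : s = (1 - v)^-1.
  apply: (mulIf (lt0r_neq0 v1)); rewrite mulVf ?lt0r_neq0//; lra.
have -> : 0 + t * (0 - 0) = 0 :> R by ring.
by rewrite e2 se /kappa; congr pt; ring.
Qed.

Lemma segment_AB M :
  segment A (pt beta 0) M <-> exists2 x, beta <= x <= 1 & M = pt x 0.
Proof.
have b1 := beta_lt1; rewrite ptA pt_on_segment.
split=> [[t /andP[t0 t1] ->]|[x /andP[bx x1] ->]].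
  exists (1 + t * (beta - 1)); last by congr pt; ring.
  have h1 : 0 <= (1 - t) * (1 - beta) by rewrite mulr_ge0 ?subr_ge0// ltW.
  have h2 : 0 <= t * (1 - beta) by rewrite mulr_ge0 ?subr_ge0// ltW.
  by apply/andP; split; lra.
exists ((1 - x) / (1 - beta)).
  rewrite divr_ge0 ?subr_ge0//= ?(ltW b1)// ler_pdivrMr ?subr_gt0//; lra.
by congr pt; field; rewrite ?subr_eq0 ?gt_eqF.
Qed.

Lemma segment_CD N :
  segment (pt 0 kappa) D N <-> exists2 y, kappa <= y <= 1 & N = pt 0 y.
Proof.
have k1 := kappa_lt1; rewrite ptD pt_on_segment.
split=> [[t /andP[t0 t1] ->]|[y /andP[ky y1] ->]].
  exists (kappa + t * (1 - kappa)); last by congr pt; ring.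
  have h1 : 0 <= (1 - t) * (1 - kappa) by rewrite mulr_ge0 ?subr_ge0// ltW.
  have h2 : 0 <= t * (1 - kappa) by rewrite mulr_ge0 ?subr_ge0// ltW.
  by apply/andP; split; lra.
exists ((y - kappa) / (1 - kappa)).
  rewrite divr_ge0 ?subr_ge0//= ?(ltW k1)// ler_pdivrMr ?subr_gt0//; lra.
by congr pt; field; rewrite ?subr_eq0 ?gt_eqF.
Qed.

Lemma op_coordinates x N : beta <= x -> segment (pt 0 kappa) D N ->
  line (pt x 0) N V -> N = pt 0 (w * x / (x - v)).
Proof.
move=> bx /segment_CD[y _ ->]; rewrite VE => /pt_on_line[t /(pt_inj D0)[e1 e2]].
have xv : 0 < x - v by rewrite subr_gt0 (lt_le_trans beta_gtv).
congr pt; apply: (mulIf (lt0r_neq0 xv)); rewrite divfK ?lt0r_neq0//.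
have -> : x - v = t * x by rewrite e1; ring.
by rewrite e2; ring.
Qed.

Lemma op_A : w * 1 / (1 - v) = kappa. Proof. by rewrite mulr1. Qed.

Lemma op_B : w * beta / (beta - v) = 1.
Proof.
have bv : 0 < beta - v by rewrite subr_gt0 beta_gtv.
apply: (mulIf (lt0r_neq0 bv)); rewrite divfK ?lt0r_neq0// mul1r.
by rewrite /beta; field; rewrite lt0r_neq0.
Qed.

(* An affine function of t that is at most p for t = 0 and for the parameter
   p x / (q y + p x) of the point on the diagonal is at most p in between. *)
Let below_diagonal (p q x y t : R) : 0 < p -> 0 < q * y + p * x -> 0 < x <= 1 ->
  0 <= t -> x * y <= q * y + p * x -> t * (q * y + p * x) <= p * x ->
  (1 - t) * x * p + t * y * (1 - q) <= p.
Proof.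
move=> p0 S0 /andP[x0 x1] t0 xy tS.
have xp : x * p <= p by rewrite -[leRHS]mul1r ler_wpM2r// ltW.
have -> : (1 - t) * x * p + t * y * (1 - q) = x * p + t * (y * (1 - q) - x * p).
  by ring.
have [h|h] := leP (y * (1 - q) - x * p) 0.
  by rewrite (le_trans _ xp)// gerDl mulr_ge0_le0.
rewrite -(ler_pM2r S0).
have h1 : t * (q * y + p * x) * (y * (1 - q) - x * p) <=
  p * x * (y * (1 - q) - x * p) by rewrite ler_wpM2r// ltW.
have h2 : p * (x * y) <= p * (q * y + p * x) by rewrite ler_wpM2l// ltW.
lra.
Qed.

(** The segment meets the ray OV at the point of parameter k = xy / (xw + yv),
    and k <= 1 is the inequality on the right. If it holds, the two parts of the
    segment lie in the two triangles cut off by the diagonal OV, since their ends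
    do. *)
Lemma segment_in_region x y : 0 < x <= 1 -> 0 < y <= 1 ->
  segment (pt x 0) (pt 0 y) `<=` quadrilateral_region O A V D <->
  x * y <= v * y + w * x.
Proof.
move=> /andP[x0 x1] /andP[y0 y1].
have s0 : 0 < x * w + y * v by rewrite addr_gt0// mulr_gt0.
rewrite /quadrilateral_region VE ptA ptD.
split=> [sub|xy _ /pt_on_segment[t /andP[t0 t1] ->]].
  pose k := x * y / (x * w + y * v).
  have kE : k * (x * w + y * v) = x * y by rewrite divfK ?lt0r_neq0.
  have : segment (pt x 0) (pt 0 y) (pt (k * v) (k * w)).
    apply/pt_on_segment; exists (x * w / (x * w + y * v)).
      have xw : 0 <= x * w by rewrite ltW// mulr_gt0.
      have yv : 0 <= y * v by rewrite ltW// mulr_gt0.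
      by rewrite divr_ge0// ?(ltW s0)//= ler_pdivrMr// mul1r lerDl.
    by congr pt; rewrite /k; field; rewrite lt0r_neq0.
  have k1 : k <= 1 -> x * y <= v * y + w * x.
    by rewrite /k ler_pdivrMr// mul1r; lra.
  move=> /sub[] /(pt_triangle _ _ _ _ _ _ _ D0)[r [s [r0 s0' rs e1 e2]]]; apply: k1.
  - have : k = s by apply: (mulIf (lt0r_neq0 w0)); move: e2; lra.
    lra.
  - have : k = r by apply: (mulIf (lt0r_neq0 v0)); move: e1; lra.
    lra.
have [h|h] := leP (v * (t * y)) (w * ((1 - t) * x)).
- left; apply/(pt_triangle _ _ _ _ _ _ _ D0).
  exists ((1 - t) * x - v * (t * y) / w), (t * y / w).
  have bd : (1 - t) * x * w + t * y * (1 - v) <= w.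
    by apply: below_diagonal => //; rewrite ?x0//; lra.
  have ty : 0 <= t * y by rewrite mulr_ge0// ltW.
  split.
  + by rewrite subr_ge0 ler_pdivrMr//; lra.
  + by rewrite divr_ge0// ltW.
  + have -> : (1 - t) * x - v * (t * y) / w + t * y / w =
      ((1 - t) * x * w + t * y * (1 - v)) / w by field; rewrite lt0r_neq0.
    by rewrite ler_pdivrMr// mul1r.
  + by field; rewrite lt0r_neq0.
  + by field; rewrite lt0r_neq0.
- right; apply/(pt_triangle _ _ _ _ _ _ _ D0).
  exists ((1 - t) * x / v), (t * y - w * ((1 - t) * x) / v).
  have bd : (1 - (1 - t)) * y * v + (1 - t) * x * (1 - w) <= v.
    by apply: below_diagonal => //; rewrite ?y0//; lra.
  have tx : 0 <= (1 - t) * x by rewrite mulr_ge0 ?subr_ge0// ltW.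
  split.
  + by rewrite divr_ge0// ltW.
  + by rewrite subr_ge0 ler_pdivrMr//; lra.
  + have -> : (1 - t) * x / v + (t * y - w * ((1 - t) * x) / v) =
      ((1 - (1 - t)) * y * v + (1 - t) * x * (1 - w)) / v by field; rewrite lt0r_neq0.
    by rewrite ler_pdivrMr// mul1r.
  + by field; rewrite lt0r_neq0.
  + by field; rewrite lt0r_neq0.
Qed.

End reflex_vertex.
End oblique_coordinates.

(** * The direction of a line relative to the angle at O *)

Section polar_angles.
Context {R : realType}.
Implicit Types (O A D U W P : R * R) (t r : R).

Lemma enorm_sqr P : enorm P ^+ 2 = P.1 ^+ 2 + P.2 ^+ 2.
Proof. by rewrite sqr_sqrtr// addr_ge0 ?sqr_ge0. Qed.

Lemma enorm_ge0 P : 0 <= enorm P.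
Proof. exact: sqrtr_ge0. Qed.

Lemma enormZ t P : enorm (t *: P) = `|t| * enorm P.
Proof.
rewrite /enorm.
have -> : (t *: P).1 ^+ 2 + (t *: P).2 ^+ 2 = t ^+ 2 * (P.1 ^+ 2 + P.2 ^+ 2).
  have -> : (t *: P).1 = t * P.1 by [].
  have -> : (t *: P).2 = t * P.2 by [].
  ring.
by rewrite sqrtrM ?sqr_ge0// sqrtr_sqr.
Qed.

Lemma cross_enorm_gt0 U W : cross U W != 0 -> 0 < enorm U /\ 0 < enorm W.
Proof.
move=> D0; rewrite !lt_def !enorm_ge0 !andbT.
split; apply: contra_neq D0 => E; have := enorm_sqr; rewrite /cross.
- move=> /(_ U); rewrite E expr0n/= => /esym/eqP.
  rewrite paddr_eq0 ?sqr_ge0// !sqrf_eq0 => /andP[/eqP -> /eqP ->].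
  by rewrite !mul0r subrr.
- move=> /(_ W); rewrite E expr0n/= => /esym/eqP.
  rewrite paddr_eq0 ?sqr_ge0// !sqrf_eq0 => /andP[/eqP -> /eqP ->].
  by rewrite !mulr0 subrr.
Qed.

(** The sine comes from the identity |U|^2 |W|^2 = (U . W)^2 + (U x W)^2. *)
Lemma angleP O A D (U := A - O) (W := D - O) (g := angle O A D) :
  cross U W != 0 ->
  [/\ 0 < g < pi, enorm U * enorm W * cos g = U.1 * W.1 + U.2 * W.2 &
      enorm U * enorm W * sin g = `|cross U W|].
Proof.
move=> D0; have [a0 d0] := cross_enorm_gt0 D0.
have ad0 : 0 < enorm U * enorm W by exact: mulr_gt0.
rewrite /g /angle -/U -/W; set x := _ / _.
have xE : enorm U * enorm W * x = U.1 * W.1 + U.2 * W.2.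
  by rewrite /x mulrC divfK// lt0r_neq0.
have lagrange : (enorm U * enorm W) ^+ 2 * (1 - x ^+ 2) = cross U W ^+ 2.
  by rewrite mulrBr mulr1 -exprMn xE exprMn !enorm_sqr /cross; ring.
have D2 : 0 < cross U W ^+ 2 by rewrite exprn_even_gt0.
have x2 : x ^+ 2 < 1.
  by rewrite -subr_gt0 -(pmulr_rgt0 _ (exprn_gt0 2 ad0)) lagrange.
have /andP[x1 x1'] : -1 < x < 1 by rewrite -ltr_norml -sqrtr_sqr -sqrtr1 ltr_sqrt.
have xI : -1 <= x <= 1 by rewrite !ltW.
split.
- by rewrite acos_gt0 ?acos_ltpi// ?x1 ?x1' ?ltW.
- by rewrite acosK.
- rewrite sin_acos// -[X in X * _](gtr0_norm ad0) -sqrtr_sqr -sqrtrM ?sqr_ge0//.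
  by rewrite lagrange sqrtr_sqr.
Qed.

Lemma polar P : 0 < enorm P ->
  exists t, P.1 = enorm P * cos t /\ P.2 = enorm P * sin t.
Proof.
move=> r0; pose x := P.1 / enorm P.
have xE : enorm P * x = P.1 by rewrite /x mulrC divfK// lt0r_neq0.
have e : (enorm P) ^+ 2 * (1 - x ^+ 2) = P.2 ^+ 2.
  by rewrite mulrBr mulr1 -exprMn xE enorm_sqr; ring.
have x2 : x ^+ 2 <= 1.
  by rewrite -subr_ge0 -(pmulr_rge0 _ (exprn_gt0 2 r0)) e sqr_ge0.
have xI : -1 <= x <= 1 by rewrite -ler_norml -sqrtr_sqr -sqrtr1 ler_sqrt.
have s : enorm P * sin (acos x) = `|P.2|.
  rewrite sin_acos// -[X in X * _](gtr0_norm r0) -sqrtr_sqr -sqrtrM ?sqr_ge0//.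
  by rewrite e sqrtr_sqr.
have [h|h] := leP 0 P.2.
- by exists (acos x); rewrite acosK// s ger0_norm.
- exists (- acos x); rewrite cosN sinN acosK// mulrN s ltr0_norm//.
  by rewrite opprK.
Qed.

Definition normal_dot P t : R := P.1 * cos t + P.2 * sin t.

(** The direction of the normal measured in the frame of the half-lines; the
    sense of rotation depends on the orientation of the quadrilateral. *)
Definition turned (eps : bool) (t0 t : R) : R := if eps then t + t0 else t0 - t.

Lemma normal_dot_turned O A D (U := A - O) (W := D - O) (g := angle O A D) :
  cross U W != 0 -> exists eps t0, forall t,
    normal_dot U t = enorm U * sin (turned eps t0 t - g) /\
    normal_dot W t = enorm W * sin (turned eps t0 t).
Proof.
move=> D0; have [a0 d0] := cross_enorm_gt0 D0.
have [gI dotE crossE] := angleP D0; rewrite -/U -/W -/g in gI dotE crossE.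
have [del [W1 W2]] := polar d0.
pose eps := cross U W < 0.
(* U in the orthonormal frame whose first vector points along W *)
have U1 : U.1 * cos del + U.2 * sin del = enorm U * cos g.
  apply: (mulIf (lt0r_neq0 d0)); rewrite mulrAC dotE W1 W2; ring.
pose sg : R := if eps then 1 else -1.
have U2 : U.2 * cos del - U.1 * sin del = sg * (enorm U * sin g).
  apply: (mulIf (lt0r_neq0 d0)).
  have -> : (U.2 * cos del - U.1 * sin del) * enorm W = - cross U W.
    by rewrite /cross W1 W2; ring.
  rewrite -mulrA (mulrAC (enorm U)) crossE /sg /eps.
  by case: ltrP => h; [rewrite ltr0_norm ?mul1r|rewrite ger0_norm ?mulN1r].
exists eps, (if eps then - del + pi / 2 else del + pi / 2) => t.
have tauE : turned eps (if eps then - del + pi / 2 else del + pi / 2) t =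
   sg * (t - del) + pi / 2.
  by rewrite /turned /sg; case: (eps); ring.
rewrite tauE.
have st : sin (sg * (t - del) + pi / 2) = cos (t - del).
  rewrite sinDpihalf /sg; case: (eps); rewrite ?mul1r ?mulN1r ?cosN//.
have ct : cos (sg * (t - del) + pi / 2) = - sg * sin (t - del).
  rewrite cosDpihalf /sg; case: (eps); first by rewrite mul1r mulN1r.
  by rewrite mulN1r sinN !opprK mul1r.
split; last by rewrite st cosB /normal_dot W1 W2; ring.
rewrite sinB st ct.
have -> : enorm U * (cos (t - del) * cos g - - sg * sin (t - del) * sin g) =
  cos (t - del) * (enorm U * cos g) + sin (t - del) * (sg * (enorm U * sin g)).
  by ring.
rewrite -U1 -U2 cosB sinB /normal_dot.
transitivity ((U.1 * cos t + U.2 * sin t) * (cos del ^+ 2 + sin del ^+ 2)).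
  by rewrite cos2Dsin2 mulr1.
by ring.
Qed.

End polar_angles.

(** * The lines that carry a chord of the quadrilateral *)

(** A line whose normal has the products x and y with the sides U and W, and
    which lies at the signed distance s from O, meets them at the fractions s / x
    and s / y. Multiplied out, the conditions on these fractions contain no
    quotient, which makes their measurability clear. *)
Definition hits (R : realType) (U W : R * R) (v w b c l x y s : R) : bool :=
  [&& 0 < x * y, b * x ^+ 2 <= s * x, s * x <= x ^+ 2, c * y ^+ 2 <= s * y,
      s ^+ 2 <= s * (v * x + w * y) & `|s| * `|cross U W| <= l * (x * y)].

Section lines_carrying_chords.
Context {R : realType}.
Variables (O A V D : R * R) (v w : R).
Let U := A - O.
Let W := D - O.
Local Notation pt := (pt O U W).
Hypotheses (D0 : cross U W != 0) (VE : V = pt v w).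
Hypotheses (v0 : 0 < v) (w0 : 0 < w) (vw : v + w < 1).
Local Notation beta := (beta v w).
Local Notation kappa := (kappa v w).

Local Notation hits_UW := (hits U W v w beta kappa).

Let cs (t : R) := cos2Dsin2 t.

Lemma normal_dot_neq0 t : normal_dot U t = 0 -> normal_dot W t = 0 -> False.
Proof.
rewrite /normal_dot => x0 y0.
have c0 : cos t = 0.
  apply: (mulfI D0); rewrite mulr0.
  transitivity (W.2 * (U.1 * cos t + U.2 * sin t) - U.2 * (W.1 * cos t + W.2 * sin t)).
    by rewrite /cross; ring.
  by rewrite x0 y0 !mulr0 subrr.
have s0 : sin t = 0.
  apply: (mulfI D0); rewrite mulr0.
  transitivity (U.1 * (W.1 * cos t + W.2 * sin t) - W.1 * (U.1 * cos t + U.2 * sin t)).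
    by rewrite /cross; ring.
  by rewrite x0 y0 !mulr0 subrr.
by have := cs t; rewrite c0 s0 expr0n/= addr0 => /esym/eqP; rewrite oner_eq0.
Qed.

(** The vector xW - yU is orthogonal to the normal and its length is the cross
    product of the sides. *)
Lemma dist_chord t m n (x := normal_dot U t) (y := normal_dot W t) s :
  0 < x * y -> m * x = s -> n * y = s ->
  x * y * dist (pt m 0) (pt 0 n) = `|s| * `|cross U W|.
Proof.
move=> xy ms ns.
have e : (x * y) ^+ 2 * ((n * W.1 - m * U.1) ^+ 2 + (n * W.2 - m * U.2) ^+ 2) =
    (s * cross U W) ^+ 2.
  transitivity ((n * y * (x * W.1) - m * x * (y * U.1)) ^+ 2 +
     (n * y * (x * W.2) - m * x * (y * U.2)) ^+ 2); first by ring.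
  rewrite ms ns.
  transitivity ((s * cross U W) ^+ 2 * (cos t ^+ 2 + sin t ^+ 2)).
    by rewrite /x /y /normal_dot /cross; ring.
  by rewrite cs mulr1.
rewrite -normrM -sqrtr_sqr -e sqrtrM ?sqr_ge0// sqrtr_sqr gtr0_norm//.
rewrite /dist /enorm.
have -> : (pt 0 n - pt m 0).1 = n * W.1 - m * U.1.
  by rewrite [LHS]fstB !pt1; ring.
have -> : (pt 0 n - pt m 0).2 = n * W.2 - m * U.2.
  by rewrite [LHS]sndB !pt2; ring.
by [].
Qed.

Lemma on_normal_line p t m n :
  normal_line p t (pt m n) <->
  m * normal_dot U t + n * normal_dot W t = p - normal_dot O t.
Proof.
rewrite /normal_line /mkset pt1 pt2 /normal_dot; split; lra.
Qed.

Lemma carries_chord l p t :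
  (exists M N, [/\ conc_chords O A V D (pt beta 0) (pt 0 kappa) (M, N),
     normal_line p t M, normal_line p t N & dist M N <= l]) <->
  hits_UW l (normal_dot U t) (normal_dot W t) (p - normal_dot O t).
Proof.
have bv := beta_gtv v0 w0 vw; have kw := kappa_gtw v0 w0 vw.
have b0 := lt_trans v0 bv; have k0 := lt_trans w0 kw.
have w1 : 0 < 1 - w by move: v0 vw; lra.
set x := normal_dot U t; set y := normal_dot W t; set s := p - _.
split.
- move=> [M [N [[/= MAB NCD sub] pM pN dl]]].
  have /(segment_AB O A D v0 vw)[m /andP[bm m1] ME] := MAB.
  have /(segment_CD O A D w0 vw)[n /andP[kn n1] NE] := NCD.
  rewrite {}ME {}NE in sub pM pN dl.
  have m0 := lt_le_trans b0 bm; have n0 := lt_le_trans k0 kn.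
  move/on_normal_line: pM; rewrite mul0r addr0 -/x -/s => ms.
  move/on_normal_line: pN; rewrite mul0r add0r -/y -/s => ns.
  have mI : 0 < m <= 1 by rewrite m0.
  have nI : 0 < n <= 1 by rewrite n0.
  move/(segment_in_region D0 VE v0 w0 mI nI) : sub => mn.
  have s0 : s != 0.
    apply/eqP => sE; apply: (@normal_dot_neq0 t).
      by apply: (mulfI (lt0r_neq0 m0)); rewrite -/x ms sE mulr0.
    by apply: (mulfI (lt0r_neq0 n0)); rewrite -/y ns sE mulr0.
  have xy : 0 < x * y.
    rewrite -(pmulr_rgt0 _ (mulr_gt0 m0 n0)).
    have -> : m * n * (x * y) = (m * x) * (n * y) by ring.
    by rewrite ms ns -expr2 exprn_even_gt0.
  have dE := dist_chord xy ms ns.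
  rewrite /hits xy -dE.
  apply/and5P; split=> //.
  + by rewrite -ms -mulrA -expr2 ler_wpM2r ?sqr_ge0.
  + by rewrite -ms -mulrA -expr2 -[leRHS]mul1r ler_wpM2r ?sqr_ge0.
  + by rewrite -ns -mulrA -expr2 ler_wpM2r ?sqr_ge0.
  + apply/andP; split; last by rewrite mulrC ler_wpM2r// ltW.
    have -> : s ^+ 2 = m * n * (x * y) by rewrite expr2 -{1}ms -ns; ring.
    have -> : s * (v * x + w * y) = (v * n + w * m) * (x * y).
      by rewrite mulrDr -{1}ns -ms; ring.
    by rewrite ler_wpM2r// ltW.
- move=> /and5P[xy bx x1 ky /andP[sxy sl]].
  have x0 : x != 0 by apply: contraTneq xy => ->; rewrite mul0r ltxx.
  have y0 : y != 0 by apply: contraTneq xy => ->; rewrite mulr0 ltxx.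
  have x2 : 0 < x ^+ 2 by rewrite exprn_even_gt0.
  have y2 : 0 < y ^+ 2 by rewrite exprn_even_gt0.
  pose m := s / x; pose n := s / y.
  have ms : m * x = s by rewrite /m divfK.
  have ns : n * y = s by rewrite /n divfK.
  have bm : beta <= m by rewrite -(ler_pM2r x2) expr2 [in leRHS]mulrA ms -expr2.
  have m1 : m <= 1 by rewrite -(ler_pM2r x2) mul1r [in leLHS]expr2 mulrA ms.
  have kn : kappa <= n by rewrite -(ler_pM2r y2) expr2 [in leRHS]mulrA ns -expr2.
  have m0 := lt_le_trans b0 bm; have n0 := lt_le_trans k0 kn.
  have mn : m * n <= v * n + w * m.
    rewrite -(ler_pM2r xy).
    have <- : s ^+ 2 = m * n * (x * y) by rewrite expr2 -{1}ms -ns; ring.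
    by have <- : s * (v * x + w * y) = (v * n + w * m) * (x * y)
      by rewrite mulrDr -{1}ns -ms; ring.
  have n1 : n <= 1.
    have mv : 0 < m - v by rewrite subr_gt0 (lt_le_trans bv).
    rewrite -(ler_pM2r mv) mul1r.
    have : v <= m * (1 - w) by rewrite -ler_pdivrMr.
    move: mn; lra.
  exists (pt m 0), (pt 0 n); split.
  + split=> /=.
    * by apply/(segment_AB O A D v0 vw); exists m => //; rewrite bm.
    * by apply/(segment_CD O A D w0 vw); exists n => //; rewrite kn.
    * by apply/(segment_in_region D0 VE v0 w0) => //; apply/andP.
  + by apply/on_normal_line; rewrite mul0r addr0.
  + by apply/on_normal_line; rewrite mul0r add0r.
  + by rewrite -(ler_pM2l xy) (dist_chord xy ms ns) mulrC (mulrC (x * y)) [leLHS]mulrC.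
Qed.

End lines_carrying_chords.

(** * The invariant measure of the lines as an integral over the lengths *)

Section measure_of_lines.
Context {R : realType}.
Local Notation mu := (@lebesgue_measure R).
Local Notation TR := (measurableTypeR R).
Variables (U W : R * R) (gamma v w b c : R).
Let a := enorm U.
Let d := enorm W.
Hypotheses (g : 0 < gamma < pi) (a0 : 0 < a) (d0 : 0 < d).
Hypothesis crossE : a * d * sin gamma = `|cross U W|.
Hypothesis b0 : 0 < b.
Local Notation hits := (hits U W v w b c).

(** The condition under_vertex with all its inequalities made non-strict: the
    chords of the quadrilateral form a closed set. *)
Definition closed_under (m n : R) : bool :=
  [&& b * a <= m, m <= a, c * d <= n & m * n <= v * a * n + w * d * m].

(** The density of the lines with respect to (length, direction). Directions are
    only known up to a half turn; the absolute values make the density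
    pi-periodic, and the maximum removes the lines that do not cross both
    half-lines. *)
Definition lines_by_length (l : R) (z : TR * TR) : R :=
  Num.max 0 (kern gamma z.2) *
  ((z.1 <= l) && closed_under (z.1 * `|sin z.2| / sin gamma)
     (z.1 * `|sin (z.2 - gamma)| / sin gamma))%:R.

Lemma lines_by_length_ge0 l z : 0 <= lines_by_length l z.
Proof. by rewrite mulr_ge0// le_max lexx. Qed.

Lemma measurable_closed_under :
  measurable_fun setT (fun z : TR * TR => closed_under z.1 z.2).
Proof.
apply: measurable_and; first exact: measurable_fun_ler.
apply: measurable_and; first exact: measurable_fun_ler.
apply: measurable_and; first exact: measurable_fun_ler.
apply: measurable_fun_ler; first exact: measurable_funM.
by apply: measurable_funD; exact: measurable_funM.
Qed.

Lemma measurable_lines_by_length l :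
  measurable_fun setT (lines_by_length l).
Proof.
have s0 : measurable_fun setT (fun z : TR * TR => `|sin z.2|).
  by do 2 apply: measurableT_comp => //; exact: measurable_sin.
have s1 : measurable_fun setT (fun z : TR * TR => `|sin (z.2 - gamma)|).
  apply: measurableT_comp => //; apply: measurableT_comp; first exact: measurable_sin.
  exact: measurable_funB.
apply: measurable_funM.
  apply: measurable_maxr => //; apply: measurableT_comp => //.
  exact: measurable_kern.
apply: measurable_natr_bool; apply: measurable_and; first exact: measurable_fun_ler.
apply: (measurableT_comp measurable_closed_under
  (g := fun z : TR * TR => (z.1 * `|sin z.2| / sin gamma,
                            z.1 * `|sin (z.2 - gamma)| / sin gamma))).
by apply: measurable_fun_pair; apply: measurable_funM => //; exact: measurable_funM.
Qed.

Lemma measurable_normal_dot (P : R * R) : measurable_fun setT (fun t : TR => normal_dot P t).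
Proof.
by apply: measurable_funD; apply: measurable_funM => //;
  [exact: measurable_cos|exact: measurable_sin].
Qed.

Lemma measurable_hits (O : R * R) l : measurable_fun setT (fun z : TR * TR =>
  hits l (normal_dot U z.2) (normal_dot W z.2) (z.1 - normal_dot O z.2)).
Proof.
pose x (z : TR * TR) := normal_dot U z.2.
pose y (z : TR * TR) := normal_dot W z.2.
pose s (z : TR * TR) := z.1 - normal_dot O z.2.
have mx : measurable_fun setT x.
  by apply: measurableT_comp => //; exact: measurable_normal_dot.
have my : measurable_fun setT y.
  by apply: measurableT_comp => //; exact: measurable_normal_dot.
have ms : measurable_fun setT s.
  apply: measurable_funB => //; apply: measurableT_comp => //.
  exact: measurable_normal_dot.
have mM (p q : TR * TR -> R) : measurable_fun setT p -> measurable_fun setT q ->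
  measurable_fun setT (fun z => p z * q z) by move=> *; exact: measurable_funM.
have mX (p : TR * TR -> R) : measurable_fun setT p ->
  measurable_fun setT (fun z => p z ^+ 2) by move=> *; exact: measurable_funX.
have mc (k : R) : measurable_fun setT (fun _ : TR * TR => k) by [].
rewrite /hits; apply: measurable_and.
  by apply: measurable_fun_ltr; [exact: mc|exact: (mM x y)].
apply: measurable_and.
  by apply: measurable_fun_ler; [apply: mM; [exact: mc|exact: (mX x)]|exact: (mM s x)].
apply: measurable_and.
  by apply: measurable_fun_ler; [exact: (mM s x)|exact: (mX x)].
apply: measurable_and.
  by apply: measurable_fun_ler; [apply: mM; [exact: mc|exact: (mX y)]|exact: (mM s y)].
apply: measurable_and.
  apply: measurable_fun_ler; first exact: (mX s).
  apply: (mM s) => //; apply: measurable_funD; apply: mM;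
    by [exact: mc|exact: mx|exact: my].
have mn : measurable_fun setT (fun z => `|s z|) by exact: measurableT_comp.
apply: measurable_fun_ler; first exact: (mM _ (fun _ => `|cross U W|) mn (mc _)).
exact: (mM (fun _ => l) _ (mc _) (mM x y mx my)).
Qed.

(** For a fixed direction the offset is kern * length, up to a sign that depends on
    the choice of the normal. *)
Lemma hits_feet l tau lam : 0 < kern gamma tau ->
  hits l (a * sin (tau - gamma)) (d * sin tau)
    (Num.sg (sin tau) * kern gamma tau * lam) =
  (lam <= l) && closed_under (lam * `|sin tau| / sin gamma)
     (lam * `|sin (tau - gamma)| / sin gamma).
Proof.
move=> k0; have G0 := sin_gt0_pi g.
have ST0 : 0 < sin tau * sin (tau - gamma).
  by move: k0; rewrite /kern pmulr_lgt0// invr_gt0.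
have S0 : 0 < `|sin tau|.
  by rewrite normr_gt0; apply: contraTneq ST0 => ->; rewrite mul0r ltxx.
have T0 : 0 < `|sin (tau - gamma)|.
  by rewrite normr_gt0; apply: contraTneq ST0 => ->; rewrite mulr0 ltxx.
have sgE : Num.sg (sin (tau - gamma)) = Num.sg (sin tau).
  have := gtr0_sg ST0; rewrite sgrM => E.
  have s2 : Num.sg (sin tau) ^+ 2 = 1 by rewrite sqr_sg -normr_gt0 S0.
  have := congr1 (fun z => Num.sg (sin tau) * z) E.
  by rewrite mulrA -expr2 s2 mul1r mulr1.
have kE : kern gamma tau = `|sin tau| * `|sin (tau - gamma)| / sin gamma.
  by rewrite -normrM (gtr0_norm ST0).
rewrite kE; move: sgE (numEsg (sin tau)) (numEsg (sin (tau - gamma))) => ->.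
set S := `|sin tau| in S0 *; set T := `|sin (tau - gamma)| in T0 *.
set sg := Num.sg (sin tau) => SE TE.
have sg2 : sg ^+ 2 = 1 by rewrite sqr_sg -normr_gt0 S0.
have sgn : `|sg| = 1 by rewrite normr_sg -normr_gt0 S0.
rewrite SE TE; set G := sin gamma in G0 *.
have Gn0 : G != 0 by rewrite gt_eqF.
rewrite /hits /closed_under -crossE -/G.
set m := lam * S / G; set n := lam * T / G.
have -> : 0 < a * (sg * T) * (d * (sg * S)).
  have -> : a * (sg * T) * (d * (sg * S)) = sg ^+ 2 * (a * T * (d * S)) by ring.
  by rewrite sg2 mul1r !mulr_gt0.
have -> : (b * (a * (sg * T)) ^+ 2 <= sg * (S * T / G) * lam * (a * (sg * T))) =
    (b * a <= m).
  rewrite -[RHS](@ler_pM2r _ (a * T ^+ 2)) ?mulr_gt0 ?exprn_gt0//.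
  congr (_ <= _).
    by transitivity (sg ^+ 2 * (b * a * (a * T ^+ 2))); [ring|rewrite sg2 mul1r].
  transitivity (sg ^+ 2 * (m * (a * T ^+ 2))); last by rewrite sg2 mul1r.
  by rewrite /m; field.
have -> : (sg * (S * T / G) * lam * (a * (sg * T)) <= (a * (sg * T)) ^+ 2) =
    (m <= a).
  rewrite -[RHS](@ler_pM2r _ (a * T ^+ 2)) ?mulr_gt0 ?exprn_gt0//.
  congr (_ <= _); last first.
    by transitivity (sg ^+ 2 * (a * (a * T ^+ 2))); [ring|rewrite sg2 mul1r].
  transitivity (sg ^+ 2 * (m * (a * T ^+ 2))); last by rewrite sg2 mul1r.
  by rewrite /m; field.
have -> : (c * (d * (sg * S)) ^+ 2 <= sg * (S * T / G) * lam * (d * (sg * S))) =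
    (c * d <= n).
  rewrite -[RHS](@ler_pM2r _ (d * S ^+ 2)) ?mulr_gt0 ?exprn_gt0//.
  congr (_ <= _).
    by transitivity (sg ^+ 2 * (c * d * (d * S ^+ 2))); [ring|rewrite sg2 mul1r].
  transitivity (sg ^+ 2 * (n * (d * S ^+ 2))); last by rewrite sg2 mul1r.
  by rewrite /n; field.
have -> : ((sg * (S * T / G) * lam) ^+ 2 <=
    sg * (S * T / G) * lam * (v * (a * (sg * T)) + w * (d * (sg * S)))) =
    (m * n <= v * a * n + w * d * m).
  rewrite -[RHS](@ler_pM2r _ (S * T)) ?mulr_gt0//.
  congr (_ <= _).
    transitivity (sg ^+ 2 * (m * n * (S * T))); last by rewrite sg2 mul1r.
    by rewrite /m /n; field.
  transitivity (sg ^+ 2 * ((v * a * n + w * d * m) * (S * T))); last by rewrite sg2 mul1r.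
  by rewrite /m /n; field.
have -> : (`|sg * (S * T / G) * lam| * (a * d * G) <=
    l * (a * (sg * T) * (d * (sg * S)))) = (`|lam| <= l).
  rewrite -[RHS](@ler_pM2r _ (a * d * S * T)) ?(mulr_gt0 (mulr_gt0 (mulr_gt0 a0 d0) S0) T0)//.
  congr (_ <= _).
    rewrite !normrM sgn normfV (gtr0_norm S0) (gtr0_norm T0) (gtr0_norm G0).
    by field.
  by transitivity (sg ^+ 2 * (l * (a * d * S * T))); [ring|rewrite sg2 mul1r].
have [bm|_] := leP (b * a) m; last by rewrite /= andbF.
have lam0 : 0 < lam.
  have : 0 < m by rewrite (lt_le_trans _ bm)// mulr_gt0.
  by rewrite /m -mulrA pmulr_lgt0// divr_gt0.
rewrite (gtr0_norm lam0) /=.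
by rewrite andbC -!andbA; do !bool_congr.
Qed.

Local Open Scope ereal_scope.

Definition lines_by_angle (l : R) (tau : TR) : \bar R :=
  \int[mu]_lam (lines_by_length l (lam, tau))%:E.

Lemma measurable_lines_by_angle l : measurable_fun setT (lines_by_angle l).
Proof.
apply: (@measurable_fun_fubini_tonelli_G _ _ TR TR R mu
  (fun z => (lines_by_length l z)%:E)).
- by apply/measurable_EFinP; exact: measurable_lines_by_length.
- by move=> z; rewrite lee_fin lines_by_length_ge0.
Qed.

Lemma lines_by_angle_ge0 l tau : 0 <= lines_by_angle l tau.
Proof. by apply: integral_ge0 => lam _; rewrite lee_fin lines_by_length_ge0. Qed.

Lemma lines_by_angle_periodic l tau : lines_by_angle l (tau + pi)%R = lines_by_angle l tau.
Proof.
apply: eq_integral => lam _; rewrite /lines_by_length /=.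
have s1 t : sin (t + pi) = (- sin t :> R)%R by rewrite sinDpi.
have s2 : sin (tau + pi - gamma) = (- sin (tau - gamma) :> R)%R.
  by rewrite addrAC sinDpi.
by rewrite /kern s1 s2 mulrNN !normrN.
Qed.

Lemma measurable_hit_lines (O : R * R) l :
  measurable [set z : TR * TR |
    hits l (normal_dot U z.2) (normal_dot W z.2) (z.1 - normal_dot O z.2)].
Proof.
rewrite -[X in measurable X]setTI.
exact: (measurable_hits O l measurableT (Y := [set true])).
Qed.

(** The lines of a given direction, parametrized by the length instead of the
    offset: an affine substitution of slope kern. *)
Lemma section_measure (O : R * R) l t tau :
  normal_dot U t = (a * sin (tau - gamma))%R -> normal_dot W t = (d * sin tau)%R ->
  mu [set p | hits l (normal_dot U t) (normal_dot W t) (p - normal_dot O t)] =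
  lines_by_angle l tau.
Proof.
have mY : measurable [set p : TR |
    hits l (normal_dot U t) (normal_dot W t) (p - normal_dot O t)].
  have := measurable_ysection t (measurable_hit_lines O l).
  by rewrite /ysection; under eq_set do rewrite inE.
move=> xE yE; rewrite xE yE in mY *.
have [k0|k0] := leP (kern gamma tau) 0%R.
  rewrite [X in mu X](_ : _ = set0).
    rewrite measure0 /lines_by_angle integral0_eq// => lam _.
    by rewrite /lines_by_length /= (max_l k0) mul0r.
  apply/seteqP; split => // p /= /and5P[xy _ _ _ _].
  suff : (0 < kern gamma tau)%R by rewrite ltNge k0.
  rewrite /kern divr_gt0 ?sin_gt0_pi//.
  have e : (a * sin (tau - gamma) * (d * sin tau) = a * d * (sin tau * sin (tau - gamma)))%R.
    by ring.
  by move: xy; rewrite e pmulr_rgt0// mulr_gt0.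
pose r := (Num.sg (sin tau) * kern gamma tau)%R.
have s0 : sin tau != 0%R.
  by apply: contraTneq k0 => s0; rewrite /kern s0 mul0r mul0r ltxx.
have r0 : r != 0%R by rewrite mulf_neq0 ?sgr_eq0// gt_eqF.
have rE : `|r|%R = kern gamma tau.
  by rewrite normrM normr_sg s0 mul1r gtr0_norm.
rewrite (@lebesgue_measure_affine R r (normal_dot O t))// rE.
set X := _ @^-1` _.
have mX : measurable X.
  rewrite -[X]setTI; apply: (@measurable_affine R r (normal_dot O t)) => //.
have XE lam : X lam = hits l (a * sin (tau - gamma)) (d * sin tau) (r * lam) :> Prop.
  by rewrite /X /= addrK.
rewrite /lines_by_angle.
under eq_integral.
  move=> lam _.
  rewrite (_ : (lines_by_length l (lam, tau))%:E =
      (kern gamma tau)%:E * (\1_X lam)%:E); last first.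
    rewrite /lines_by_length (max_r (ltW k0)) -EFinM indicE.
    congr (_ * (nat_of_bool _)%:R)%:E; rewrite -(hits_feet _ _ k0).
    by apply/idP/idP; rewrite inE XE.
  over.
rewrite ge0_integralZl//; last 2 first.
  by apply/measurable_EFinP; exact: measurable_indic.
  by rewrite lee_fin ltW.
by rewrite integral_indic// setIT.
Qed.

Lemma product_measure_section (O : R * R) l (turn : R -> R) :
  (forall t, normal_dot U t = (a * sin (turn t - gamma))%R /\
             normal_dot W t = (d * sin (turn t))%R) ->
  (mu \x mu) [set z : TR * TR | (0 <= z.2 < pi)%R /\
    hits l (normal_dot U z.2) (normal_dot W z.2) (z.1 - normal_dot O z.2)] =
  \int[mu]_(t in `[0%R, pi[) lines_by_angle l (turn t).
Proof.
move=> turnE; set S := mkset _.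
have mS : measurable S.
  apply: measurableI; last exact: measurable_hit_lines.
  rewrite [X in measurable X](_ : _ = [set: TR] `*` `[0%R, pi[%classic); last first.
    by apply/seteqP; split=> z /=; rewrite in_itv/=; [split|case].
  by apply: measurableX.
transitivity (\int[mu]_p fubini_F mu (EFin \o (\1_S : TR * TR -> R)) p).
  by rewrite indic_fubini_tonelli_FE.
rewrite (@indic_fubini_tonelli _ _ TR TR R mu mu S mS) indic_fubini_tonelli_GE//.
rewrite [RHS]integral_mkcond; apply: eq_integral => t _.
rewrite patchE /=; case: ifPn => tI.
  have [xE yE] := turnE t; rewrite -(section_measure O l xE yE); congr (mu _).
  apply/seteqP; split=> p; rewrite /ysection/= inE /S/=; first by case.
  by move: tI; rewrite inE/= in_itv.
rewrite [X in mu X](_ : _ = set0) ?measure0//.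
apply/seteqP; split=> // p; rewrite /ysection/= inE /S/= => -[tI' _].
by move: tI; rewrite notin_setE/= in_itv/= tI'.
Qed.

(** By periodicity the frame in which directions are measured does not matter; in
    the frame of the half-lines only the directions in ]gamma, pi[ contribute. *)
Lemma lines_by_angle_turned l eps t0 :
  \int[mu]_(t in `[0%R, pi[) lines_by_angle l (turned eps t0 t) =
  \int[mu]_(t in `]gamma, pi[) lines_by_angle l t.
Proof.
have mg : measurable_fun setT (lines_by_angle l) by exact: measurable_lines_by_angle.
have gT (t : R) : lines_by_angle l (t + pi)%R = lines_by_angle l t.
  exact: lines_by_angle_periodic.
transitivity (\int[mu]_(t in `[0%R, pi[) lines_by_angle l t).
  rewrite /turned; case: eps.
  - exact: (integral_periodic_shift (pi_gt0 R) mg (lines_by_angle_ge0 l) gT).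
  - exact: (integral_periodic_reflect (pi_gt0 R) mg (lines_by_angle_ge0 l) gT).
rewrite integral_mkcond [RHS]integral_mkcond; apply: eq_integral => t _.
rewrite !patchE !mem_setE !in_itv/=; have /andP[g0 gp] := g.
have [tpi|] := ltP t pi; rewrite ?andbF// !andbT.
have [gt|tg] := ltP gamma t; first by rewrite (ltW (lt_trans g0 gt)).
case: ifPn => // t_ge0; rewrite /lines_by_angle integral0_eq// => lam _.
rewrite /lines_by_length /= (max_l _) ?mul0r//.
rewrite /kern pmulr_lle0 ?invr_gt0 ?sin_gt0_pi//.
rewrite mulr_ge0_le0//; first by rewrite sin_ge0_pi// t_ge0 ltW.
by rewrite -oppr_ge0 -sinN opprB sin_ge0_pi// subr_ge0 tg/=; lra.
Qed.

Lemma lines_by_length_integral l :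
  \int[mu]_(t in `]gamma, pi[) lines_by_angle l t =
  \int[mu]_(lam in `[0%R, l]) (chord_density gamma lam closed_under)%:E.
Proof.
pose f (z : TR * TR) : \bar R := (lines_by_length l z * \1_(`]gamma, pi[) z.2)%:E.
have f0 z : 0 <= f z by rewrite lee_fin mulr_ge0// lines_by_length_ge0.
have mf : measurable_fun setT f.
  apply/measurable_EFinP; apply: measurable_funM; first exact: measurable_lines_by_length.
  by apply: measurableT_comp => //; exact: measurable_indic.
transitivity (\int[mu]_t \int[mu]_lam f (lam, t)).
  rewrite integral_mkcond; apply: eq_integral => t _; rewrite patchE.
  case: ifPn => tI.
    by apply: eq_integral => lam _; rewrite /f indicE /= tI mulr1.
  by rewrite integral0_eq// => lam _; rewrite /f indicE /= (negbTE tI) mulr0.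
rewrite -(fubini_tonelli f mf f0) [RHS]integral_mkcond.
apply: eq_integral => lam _.
rewrite patchE mem_setE in_itv/=.
have mP : measurable_rel closed_under by exact: measurable_closed_under.
transitivity (\int[mu]_(t in `]gamma, pi[) (lines_by_length l (lam, t))%:E).
  rewrite [RHS]integral_mkcond; apply: eq_integral => t _; rewrite patchE /f indicE /=.
  by case: ifPn => tI; rewrite ?mulr1 ?mulr0.
have feetE t : (gamma < t < pi)%R -> lines_by_length l (lam, t) =
    ((lam <= l)%R%:R * (kern gamma t *
      (closed_under (foot1 gamma lam t) (foot2 gamma lam t))%:R))%R.
  move=> tI; rewrite /lines_by_length /= (max_r (ltW (kern_gt0 g tI))).
  have /andP[gt tpi] := tI; have /andP[g0 gp] := g.
  rewrite [X in (_ * X / _)%R]gtr0_norm ?sin_gt0_pi ?(lt_trans g0)//.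
  rewrite [X in (closed_under _ (_ * X / _))%R]gtr0_norm; last first.
    by apply: sin_gt0_pi; rewrite subr_gt0 gt/=; lra.
  by case: (lam <= l)%R; rewrite ?mul1r ?mul0r ?mulr0.
transitivity (((lam <= l)%R%:R * chord_density gamma lam closed_under)%:E).
  rewrite /chord_density EFinM /Rintegral fineK; last first.
    by apply: integrable_fin_num => //; apply: integrable_chord => //; exact: itv_finite.
  rewrite -integralZl//; last by apply: integrable_chord => //; exact: itv_finite.
  by apply: eq_integral => t; rewrite inE/= in_itv/= => tI; rewrite feetE.
case: (leP 0%R lam) => lam0 /=; first by case: (lam <= l)%R; rewrite ?mul1r ?mul0r.
rewrite (_ : chord_density _ _ _ = 0)%R ?mulr0//.
rewrite -[RHS](chord_density0 gamma lam); apply: eq_Rintegral => t.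
rewrite inE/= in_itv/= => tI; rewrite /closed_under leNgt.
rewrite (lt_le_trans _ (_ : 0 <= b * a)%R)//; last by rewrite mulr_ge0// ltW.
rewrite /foot1 -mulrA nmulr_rlt0// divr_gt0 ?sin_gt0_pi//.
by have /andP[gt ->] := tI; have /andP[g0 _] := g; rewrite (lt_trans g0).
Qed.

Lemma measure_hit_lines (O : R * R) l eps t0 :
  (forall t, normal_dot U t = (a * sin (turned eps t0 t - gamma))%R /\
             normal_dot W t = (d * sin (turned eps t0 t))%R) ->
  (mu \x mu) [set z : TR * TR | (0 <= z.2 < pi)%R /\
    hits l (normal_dot U z.2) (normal_dot W z.2) (z.1 - normal_dot O z.2)] =
  \int[mu]_(lam in `[0%R, l]) (chord_density gamma lam closed_under)%:E.
Proof.
move=> turnE; apply: etrans (product_measure_section O l turnE) _.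
exact: etrans (lines_by_angle_turned l eps t0) (lines_by_length_integral l).
Qed.

End measure_of_lines.

(** * Differentiation of the distribution function *)

Section closed_and_half_open.
Context {R : realType}.
Local Notation mu := (@lebesgue_measure R).
Variables (gamma a b c e h : R).
Hypotheses (g : 0 < gamma < pi) (b0 : 0 < b) (a0 : 0 < a) (c0 : 0 < c) (h0 : 0 < h).
Local Notation under := (under_vertex a b c e h).

Lemma chord_density_length0 (P : R -> R -> bool) :
  (forall m n, P m n -> b <= m) -> chord_density gamma 0 P = 0.
Proof.
move=> Pb; rewrite -[RHS](chord_density0 gamma 0); apply: eq_Rintegral => t _.
by case: (boolP (P _ _)) => // /Pb; rewrite /foot1 !mul0r leNgt b0.
Qed.

(** Conditions that agree off their common boundary differ only at critical
    angles. *)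
Lemma chord_density_boundary l (P : R -> R -> bool) : 0 <= l -> measurable_rel P ->
  (forall m n, P m n -> b <= m) ->
  (forall m n, m != b -> m != a -> n != c -> m * n != e * n + h * m ->
     P m n = under m n) ->
  chord_density gamma l P = chord_density gamma l under.
Proof.
move=> l_ge0 mP Pb PE; have mU := @measurable_under_vertex R a b c e h.
move: l_ge0; rewrite le_eqVlt => /predU1P[<-|l0].
  by rewrite !chord_density_length0// => m n /and4P[].
have := @chord_density_cvg R gamma (fun=> l) l (fun=> P) under
  (critical_angles gamma a b c e h l) g (fun=> mP) mU
  (null_critical_angles e g b0 a0 c0 h0 l0).
move=> /(_ _)/cvg_lim <- //; last first.
  move=> t tI nc; near=> n; apply: PE.
  - by apply/eqP => E; apply: nc; left; left; left.
  - by apply/eqP => E; apply: nc; left; left; right.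
  - by apply/eqP => E; apply: nc; left; right.
  - by apply/eqP => E; apply: nc; right.
by apply/esym/cvg_lim => //; exact: cvg_cst.
Unshelve. all: by end_near. Qed.

Lemma chord_density_le_cst l P : measurable_rel P ->
  `|chord_density gamma l P| <= (sin gamma)^-1 * (pi - gamma).
Proof.
move=> mP; have gI := @integrable_chord R gamma l P `]gamma, pi[ g mP
  (measurable_itv _) (itv_finite _ _ _ _).
apply: (le_trans (le_normr_Rintegral _ gI)) => //.
apply: (@le_trans _ _ (\int[mu]_(t in `]gamma, pi[) (sin gamma)^-1)).
  apply: le_Rintegral => //.
  - exact: integrable_norm.
  - apply: (@integrable_bounded _ _ _ (sin gamma)^-1) => //; first exact: itv_finite.
    by move=> _ _; rewrite ger0_norm// invr_ge0 ltW// sin_gt0_pi.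
  - by move=> t _; exact: chord_integrand_le.
rewrite Rintegral_cst//; have /andP[_ gp] := g.
have E : mu `]gamma, pi[ = (pi - gamma)%:E.
  by rewrite lebesgue_measure_itv/= lte_fin gp.
by rewrite [X in fine X]E.
Qed.

Lemma integrable_under_density u :
  mu.-integrable `[0, u] (EFin \o (fun l => chord_density gamma l under)).
Proof.
have mU := @measurable_under_vertex R a b c e h.
apply: (@integrable_bounded _ _ _ ((sin gamma)^-1 * (pi - gamma))) => //.
- exact: itv_finite.
- apply/measurable_fun_itv_obnd_cbndP.
  have mo : measurable_fun (`]0, +oo[%classic : set R)
      (fun l => chord_density gamma l under).
    apply: open_continuous_measurable_fun; first exact: interval_open.
    move=> x; rewrite inE/= in_itv/= andbT => x0.
    exact: continuous_under_vertex_density.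
  apply: measurable_funS mo => //.
  by move=> x /=; rewrite !in_itv/= andbT => /andP[].
- by move=> l _; exact: chord_density_le_cst.
Qed.

Lemma derive_under_density l : 0 < l ->
  let F x := \int[mu]_(lam in `[0, x]) chord_density gamma lam under in
  derivable F l 1 /\ derive1 F l = chord_density gamma l under.
Proof.
move=> l0 F; apply: (@continuous_FTC1_closed _ _ 0 l (l + 1)) => //.
- by rewrite ltrDl.
- exact: integrable_under_density.
- exact: continuous_under_vertex_density.
Qed.

End closed_and_half_open.

(** * The concave quadrilateral *)

Section approximation.
Context {R : realType}.
Local Notation mu := (@lebesgue_measure R).
Variables (O A V D : R * R) (v w : R).
Let U := A - O.
Let W := D - O.
Local Notation pt := (pt O U W).
Local Notation beta := (beta v w).
Local Notation kappa := (kappa v w).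
Hypotheses (D0 : cross U W != 0) (VE : V = pt v w).
Hypotheses (v0 : 0 < v) (w0 : 0 < w) (vw : v + w < 1).
Let B := pt beta 0.
Let C := pt 0 kappa.
Let a := enorm U.
Let d := enorm W.
Let gamma := angle O A D.
Let a0 : 0 < a. Proof. by have [] := cross_enorm_gt0 D0. Qed.
Let d0 : 0 < d. Proof. by have [] := cross_enorm_gt0 D0. Qed.
Let gI : 0 < gamma < pi. Proof. by have [] := angleP D0. Qed.
Let bv : v < beta. Proof. exact: beta_gtv. Qed.
Let kw : w < kappa. Proof. exact: kappa_gtw. Qed.
Let b0 : 0 < beta. Proof. exact: lt_trans bv. Qed.
Let k0 : 0 < kappa. Proof. exact: lt_trans kw. Qed.
Let b1 : beta < 1. Proof. exact: beta_lt1. Qed.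
Let ba0 : 0 < beta * a. Proof. exact: mulr_gt0. Qed.
Let kd0 : 0 < kappa * d. Proof. exact: mulr_gt0. Qed.
Let va0 : 0 < v * a. Proof. exact: mulr_gt0. Qed.
Let wd0 : 0 < w * d. Proof. exact: mulr_gt0. Qed.
Let vba : v * a < beta * a. Proof. by rewrite ltr_pM2r. Qed.
Let baa : beta * a < a. Proof. by rewrite gtr_pMl. Qed.
Local Notation under := (under_vertex a (beta * a) (kappa * d) (v * a) (w * d)).

Lemma dist_pt_U m : 0 <= m -> dist O (pt m 0) = m * a.
Proof.
move=> m0; rewrite /dist (_ : pt m 0 - O = m *: U) ?enormZ ?ger0_norm//.
apply: eq_pair; rewrite ?[LHS]fstB ?[LHS]sndB ?pt1 ?pt2.
- have -> : (m *: U).1 = m * U.1 by []. ring.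
- have -> : (m *: U).2 = m * U.2 by []. ring.
Qed.

Lemma dist_pt_W n : 0 <= n -> dist O (pt 0 n) = n * d.
Proof.
move=> n0; rewrite /dist (_ : pt 0 n - O = n *: W) ?enormZ ?ger0_norm//.
apply: eq_pair; rewrite ?[LHS]fstB ?[LHS]sndB ?pt1 ?pt2.
- have -> : (n *: W).1 = n * W.1 by []. ring.
- have -> : (n *: W).2 = n * W.2 by []. ring.
Qed.

Lemma chord_length_cdfE l :
  chord_length_cdf (conc_chords O A V D B C) l =
  \int[mu]_(lam in `[0, l]) chord_density gamma lam under.
Proof.
have [eps [t0 turnE]] := normal_dot_turned D0.
have [_ _ crossE] := angleP D0.
have mC : measurable_rel (closed_under U W v w beta kappa).
  exact: measurable_closed_under.
have cdfE : line_measure [set L | exists M N,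
    [/\ conc_chords O A V D B C (M, N), L M, L N & dist M N <= l]] =
    (\int[mu]_(lam in `[0%R, l])
      (chord_density gamma lam (closed_under U W v w beta kappa))%:E)%E.
  apply: etrans (measure_hit_lines v w kappa gI a0 d0 crossE b0 O l turnE).
  congr ((_ \x _)%E _); apply/seteqP; split=> z /= [zI].
    by move/(carries_chord D0 VE v0 w0 vw).
  by move=> h; split => //; apply/(carries_chord D0 VE v0 w0 vw).
transitivity (\int[mu]_(lam in `[0, l])
    chord_density gamma lam (closed_under U W v w beta kappa)).
  by rewrite /chord_length_cdf cdfE.
apply: eq_Rintegral => lam; rewrite inE/= in_itv/= => /andP[lam0 _].
apply: (chord_density_boundary gI ba0) => // [m n /and4P[]//|m n mb ma nc nv].
rewrite /closed_under /under_vertex (le_eqVlt m) (negbTE ma)/=.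
by rewrite [in LHS](le_eqVlt (m * n)) (negbTE nv).
Qed.

Lemma derive_chord_length_cdf l : 0 < l ->
  derivable (chord_length_cdf (conc_chords O A V D B C)) l 1 /\
  rho_conc O A V D B C l = chord_density gamma l under.
Proof.
move=> l0; have -> : chord_length_cdf (conc_chords O A V D B C) =
    fun l => \int[mu]_(lam in `[0, l]) chord_density gamma lam under.
  by apply/funext => x; exact: chord_length_cdfE.
rewrite /rho_conc /chord_length_density.
have -> : chord_length_cdf (conc_chords O A V D B C) =
    fun l => \int[mu]_(lam in `[0, l]) chord_density gamma lam under.
  by apply/funext => x; exact: chord_length_cdfE.
exact: (derive_under_density (v * a) gI ba0 a0 kd0 wd0 l0).
Qed.

Variable op : R * R -> R * R.
Hypothesis hop : forall M, segment A B M -> segment C D (op M) /\ line M (op M) V.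

Lemma op_pt x : beta <= x <= 1 -> op (pt x 0) = pt 0 (w * x / (x - v)).
Proof.
move=> /andP[bx x1]; have [|CD L] := hop (M := pt x 0).
  by apply/(segment_AB O A D v0 vw); exists x => //; rewrite bx.
exact: (op_coordinates D0 VE v0 w0 vw bx CD L).
Qed.

Lemma subdivision_pt n i : subdivision A B n i = pt (step 1 beta n i) 0.
Proof.
have AE : A = pt 1 0 by exact: ptA.
have BA : B - A = (beta - 1) *: U.
  rewrite {1}AE /B; apply: eq_pair; rewrite ?[LHS]fstB ?[LHS]sndB ?pt1 ?pt2.
  - have -> : ((beta - 1) *: U).1 = (beta - 1) * U.1 by []. ring.
  - have -> : ((beta - 1) *: U).2 = (beta - 1) * U.2 by []. ring.
have nBA : enorm (B - A) != 0.
  by rewrite BA enormZ mulf_neq0 ?normr_eq0 ?subr_eq0 ?(lt_eqF b1) ?(gt_eqF a0).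
rewrite /subdivision scalerA mulfK// BA scalerA.
rewrite {1}AE; apply: eq_pair; rewrite ?affine1 ?affine2 ?pt1 ?pt2 /step; ring.
Qed.

Lemma step_scale n i : step 1 beta n i * a = step a (beta * a) n i.
Proof. by rewrite /step; ring. Qed.

Lemma dist_op x : beta <= x <= 1 ->
  dist O (op (pt x 0)) = opposite (v * a) (w * d) (x * a).
Proof.
move=> xI; have /andP[bx x1] := xI.
have xv : 0 < x - v by rewrite subr_gt0 (lt_le_trans bv).
rewrite op_pt// dist_pt_W; last first.
  by rewrite divr_ge0 ?mulr_ge0 ?(ltW w0) ?(ltW xv)// (le_trans (ltW b0)).
rewrite /opposite -mulrBl; field; by rewrite !gt_eqF.
Qed.

Lemma step_in n i : (0 < n)%N -> (i <= n)%N -> beta <= step 1 beta n i <= 1.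
Proof. by move=> n0 i_n; rewrite le_step_b//= le_step_a. Qed.

(** The rectangle of distances belonging to one term of the sums; with j = i it is
    a term of the upper sum, with j = i - 1 one of the lower sum. *)
Lemma rho_cell n i j l : 0 < l -> (0 < i <= n)%N -> (j <= n)%N ->
  rho O gamma (subdivision A B n i.-1) (subdivision A B n i) C
    (op (subdivision A B n j)) l =
  chord_density gamma l (fun m k =>
    (step a (beta * a) n i <= m < step a (beta * a) n i.-1) &&
    (kappa * d <= k < opposite (v * a) (w * d) (step a (beta * a) n j))).
Proof.
move=> l0 /andP[i0 i_n] j_n; have n0 := leq_trans i0 i_n.
have pn : (i.-1 <= n)%N by rewrite (leq_trans (leq_pred _)).
have si := step_in n0 i_n; have sp := step_in n0 pn; have sj := step_in n0 j_n.
have ge0 x : beta <= x <= 1 -> 0 <= x by move=> /andP[/(le_trans (ltW b0))].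
rewrite !subdivision_pt rho_chord_density ?(ltW l0)//.
- by rewrite !dist_pt_U ?ge0// dist_op// dist_pt_W ?(ltW k0)// !step_scale.
- rewrite !dist_pt_U ?ge0// !step_scale (lt_le_trans ba0) ?le_step_b//=.
  by rewrite step_anti// leq_pred.
- rewrite dist_op// dist_pt_W ?(ltW k0)// kd0/=.
  set s := step 1 beta n j in sj *; have /andP[bs s1] := sj.
  have sv : 0 < s - v by rewrite subr_gt0 (lt_le_trans bv).
  rewrite /opposite -mulrBl ler_pdivlMr ?mulr_gt0//.
  have -> : w * d * (s * a) = w * s * (d * a) by ring.
  have -> : kappa * d * ((s - v) * a) = kappa * (s - v) * (d * a) by ring.
  rewrite ler_pM2r ?mulr_gt0//.
  have v1 : v < 1 by move: w0 vw; lra.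
  have kE : kappa * (1 - v) = w by rewrite divfK// subr_eq0 gt_eqF.
  have -> : w * s = kappa * s * (1 - v) by rewrite mulrAC kE.
  rewrite -subr_ge0.
  have -> : kappa * s * (1 - v) - kappa * (s - v) = kappa * v * (1 - s) by ring.
  by rewrite mulr_ge0 ?subr_ge0// mulr_ge0 ?(ltW k0) ?(ltW v0).
Qed.

Lemma app_plusE n l : 0 < l -> app_plus O A D B C op n l =
  chord_density gamma l (upper_stair a (beta * a) (kappa * d) (v * a) (w * d) n).
Proof.
move=> l0; rewrite -sum_upper_cells//; apply: eq_big_nat => i /andP[i0 i_n].
by rewrite rho_cell// i0.
Qed.

Lemma app_minusE n l : 0 < l -> app_minus O A D B C op n l =
  chord_density gamma l (lower_stair a (beta * a) (kappa * d) (v * a) (w * d) n).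
Proof.
move=> l0; rewrite -sum_lower_cells//; apply: eq_big_nat => i /andP[i0 i_n].
by rewrite rho_cell// ?i0// (leq_trans (leq_pred _)).
Qed.

Lemma op_ends : op A = C /\ op B = D.
Proof.
split.
- rewrite (ptA O A D) op_pt ?lexx ?(ltW b1)//; congr pt; exact: op_A.
- by rewrite op_pt ?lexx ?(ltW b1)// op_B// -/U -/W -(ptD O A D).
Qed.

Lemma app_sandwich n l : (0 < n)%N -> 0 < l ->
  app_minus O A D B C op n l <= rho_conc O A V D B C l <= app_plus O A D B C op n l.
Proof.
move=> n0 l0; have [_ ->] := derive_chord_length_cdf l0.
rewrite app_plusE// app_minusE//.
by rewrite lower_stair_density_le//= upper_stair_density_ge.
Qed.

Lemma cvg_app_minus l : 0 < l ->
  app_minus O A D B C op n l @[n --> \oo] --> rho_conc O A V D B C l.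
Proof.
move=> l0; have [_ ->] := derive_chord_length_cdf l0.
under eq_fun do rewrite app_minusE//.
exact: cvg_lower_stair_density.
Qed.

Lemma cvg_app_plus l : 0 < l ->
  app_plus O A D B C op n l @[n --> \oo] --> rho_conc O A V D B C l.
Proof.
move=> l0; have [_ ->] := derive_chord_length_cdf l0.
under eq_fun do rewrite app_plusE//.
exact: cvg_upper_stair_density.
Qed.

End approximation.

Lemma cvg_diff0 (R : realType) (x y : R^nat) (k : R) :
  x n @[n --> \oo] --> k -> y n @[n --> \oo] --> k ->
  x n - y n @[n --> \oo] --> (0 : R).
Proof. by move=> xk yk; rewrite -(subrr k); exact: cvgB. Qed.

Theorem proposition8p1 (R : realType) (O A V D B C : R * R)
    (op : R * R -> R * R)
    (hquad : concave_quadrilateral O A V D)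
    (hB : segment O A B /\ line D V B)
    (hC : segment O D C /\ line A V C)
    (hop : forall M, segment A B M ->
             segment C D (op M) /\ line M (op M) V) :
  [/\ op A = C /\ op B = D,
      forall l : R, 0 < l ->
        derivable (chord_length_cdf (conc_chords O A V D B C)) l 1,
      forall (n : nat) (l : R), (1 <= n)%N -> 0 < l ->
        app_minus O A D B C op n l <= rho_conc O A V D B C l
          <= app_plus O A D B C op n l,
      forall l : R, 0 < l ->
        app_plus O A D B C op n l - app_minus O A D B C op n l
          @[n --> \oo] --> (0 : R) &
      forall l : R, 0 < l ->
        app_minus O A D B C op n l @[n --> \oo] --> rho_conc O A V D B C l /\
        app_plus O A D B C op n l @[n --> \oo] --> rho_conc O A V D B C l].
Proof.
have [D0 [v [w [VE v0 w0 vw]]]] := concave_coordinates hquad.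
have [hB1 hB2] := hB; have [hC1 hC2] := hC.
have BE := B_coordinates D0 VE v0 vw hB1 hB2.
have CE := C_coordinates D0 VE w0 vw hC1 hC2.
subst B C.
have cvgM l (l0 : 0 < l) := cvg_app_minus D0 VE v0 w0 vw hop l0.
have cvgP l (l0 : 0 < l) := cvg_app_plus D0 VE v0 w0 vw hop l0.
split.
- exact: (op_ends D0 VE v0 w0 vw hop).
- by move=> l l0; have [] := derive_chord_length_cdf D0 VE v0 w0 vw l0.
- by move=> n l n0 l0; exact: (app_sandwich D0 VE v0 w0 vw hop).
- by move=> l l0; exact: (cvg_diff0 (cvgP l l0) (cvgM l l0)).
- by move=> l l0; split; [exact: cvgM|exact: cvgP].
Qed.
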